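(* Let $P \subset \mathbb{R}^2$ be a lattice polygon. For $k \in \mathbb{N}$, let $\operatorname{LD}_P(k)$ denote the number of lattice diameter lines of the dilated polygon $kP$. Then there exists a positive integer $q$ such that the function $\operatorname{LD}_P : \mathbb{N}_{\geq q} \to \mathbb{N}$ agrees with a quasi-polynomial function of degree one whose period divides $q$.
   Context: A lattice polygon is a two-dimensional convex polytope in $\mathbb{R}^2$ all of whose vertices lie in $\mathbb{Z}^2$. For $k \in \mathbb{N}$, $kP := \{kx : x \in P\}$, and $\mathbb{N}_{\geq q}$ denotes the set of integers $k \geq q$. For a compact set $S \subset \mathbb{R}^2$, the lattice diameter is $\operatorname{diam}_{\mathbb{Z}}(S) := \max_{x,y \in S \cap \mathbb{Z}^2} |\operatorname{conv}(\{x,y\}) \cap \mathbb{Z}^2| - 1$. If $x,y$ attain this maximum, then the line $\operatorname{aff}(\{x,y\})$ is called a lattice diameter line of $S$. A quasi-polynomial function of degree $n$ is a function of the form $f(k) = c_n(k)k^n + \dots + c_1(k)k + c_0(k)$, where $c_0,\dots,c_n$ are periodic functions of the integer $k$ and $c_n$ is not identically zero; its period is the least common period of $c_0,\dots,c_n$.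
   Formalization: ''Degree one'' is read as degree at most one (c_1 may vanish identically): for P = conv{(0,0),(1,0),(0,1)} the number of lattice diameter lines is LD_P(k) = 3 for all k ≥ 1, so strict degree one fails. *)

(* Defs.v *)
From HB Require Import structures.
From mathcomp Require Import all_boot all_order all_algebra archimedean finmap.
From mathcomp Require Import all_classical all_reals all_analysis.

Set Implicit Arguments.
Unset Strict Implicit.
Unset Printing Implicit Defensive.

Import Order.TTheory GRing.Theory Num.Theory.

Local Open Scope classical_set_scope.
Local Open Scope ring_scope.

Section Hulls.
Variables (R : realType) (V : lmodType R).
Implicit Types A P : set V.

Definition conv_hull A : set V := smallest (@convex_set R V) A.

Definition affine_set A :=
  forall (x y : V) (t : R), A x -> A y -> A ((1 - t) *: x + t *: y).

Definition aff_hull A : set V := smallest affine_set A.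

Definition polytope P := exists2 s : set V, finite_set s & P = conv_hull s.

Definition vertex P : set V :=
  [set x | P x /\ forall (y z : V) (t : R), P y -> P z -> 0 < t < 1 ->
                    x = (1 - t) *: y + t *: z -> y = x /\ z = x].

Definition dilate (k : nat) P : set V := [set k%:R *: x | x in P].

End Hulls.

Section LatticeDiameter.
Variable R : realType.
Implicit Types S P : set 'rV[R]_2.

Definition Z2 : set 'rV[R]_2 := [set x | forall i, x ord0 i \is a Num.int].

(* A subset of the plane is two-dimensional iff it affinely spans the plane. *)
Definition lattice_polygon P :=
  [/\ polytope P, aff_hull P = setT & vertex P `<=` Z2].

Definition segment_length (x y : 'rV[R]_2) : R :=
  #|` fset_set (conv_hull [set x; y] `&` Z2)|%:R - 1.

(* For compact S the supremum is taken over a finite set of values, hence it is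
   a maximum as soon as S contains a lattice point. *)
Definition lattice_diam S : R :=
  sup [set segment_length x y | x in S `&` Z2 & y in S `&` Z2].

(* The condition x <> y matters only if S contains a single lattice point: then
   aff {x, y} would not be a line. *)
Definition lattice_diam_line S (l : set 'rV[R]_2) :=
  exists x y, [/\ (S `&` Z2) x, (S `&` Z2) y, x <> y,
    segment_length x y = lattice_diam S & l = aff_hull [set x; y]].

(* fset_set sends infinite sets to the empty one; the set of lattice diameter
   lines is finite when P is bounded. *)
Definition LD P (k : nat) : nat :=
  #|` fset_set [set l | lattice_diam_line (dilate k P) l]|.

End LatticeDiameter.

Section QuasiPolynomial.
Variable R : realType.

Definition common_period (n : nat) (c : 'I_n.+1 -> int -> R) (p : nat) :=
  (0 < p)%N /\ forall i, periodic (c i) p%:Z.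

Definition quasi_polynomial (n p : nat) (f : int -> R) :=
  exists c : 'I_n.+1 -> int -> R,
    [/\ common_period c p,
        forall p', common_period c p' -> (p <= p')%N,
        exists k, c ord_max k <> 0
      & forall k, f k = \sum_(i < n.+1) c i k * k%:~R ^+ i].

End QuasiPolynomial.

(* Main.v *)
(** Write [P] as the convex hull of its vertices, and call chord length in a
primitive direction [d] the largest [t] with [x] and [x + t d] in [P].

Sliding a chord parallel to itself between two consecutive lines through
vertices changes its length affinely, so a longest chord in direction [d] can be
taken through a vertex, hence (a vertex being extreme) with a vertex as an
endpoint.  Thus the maximum [L] of all chord lengths is rational, and since
[k u] is a lattice point for a vertex [u], the lattice diameter of [kP] is
exactly [floor (k L)], for every [k].  Joining two vertices shows [L >= 1], so
that only finitely many directions can occur.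

For a fixed direction the diameter lines of [kP] are indexed by the heights [c]
for which there is an integer [a] solving a finite system of inequalities
[al a + be c + e k >= 0], where [e] is eventually quasi-linear in [k].
Eliminating [a] by Fourier-Motzkin on each residue class of [c] leaves an
interval of integers with eventually quasi-linear end points, so the number of
heights is eventually quasi-linear as well. *)

Require Import Defs.
From HB Require Import structures.
From mathcomp Require Import all_boot all_order all_algebra archimedean finmap.
From mathcomp Require Import all_classical all_reals all_analysis.
From mathcomp Require Import ring lra zify.

Set Implicit Arguments.
Unset Strict Implicit.
Unset Printing Implicit Defensive.

Import Order.TTheory GRing.Theory Num.Theory.

Local Open Scope classical_set_scope.
Local Open Scope ring_scope.

(** * Calculus of eventually quasi-linear functions *)

(* Eventually quasi-linear: on each residue class modulo [p], [g] is affine from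
   some point on, which may depend on the class. *)
Definition eqlin (g : nat -> int) := exists2 p : nat, (0 < p)%N &
  forall r, exists A B : int, exists m0 : nat, forall j, (m0 <= j)%N ->
    g (r + p * j)%N = A * j%:Z + B.

(** The product of the two moduli serves both functions: along the finer progression each slope is
    multiplied by the other modulus. *)
Lemma eqlin_common (g h : nat -> int) : eqlin g -> eqlin h ->
  exists2 p : nat, (0 < p)%N & forall r, exists A B C D : int, exists m0 : nat,
    forall j, (m0 <= j)%N ->
      g (r + p * j)%N = A * j%:Z + B /\ h (r + p * j)%N = C * j%:Z + D.
Proof.
move=> [p p0 Hg] [q q0 Hh]; exists (p * q)%N; first by rewrite muln_gt0 p0.
move=> r; have [A [B [m Hm]]] := Hg r; have [C [D [m' Hm']]] := Hh r.
exists (A * q%:Z), B, (C * p%:Z), D, (maxn m m') => j; rewrite geq_max => /andP[mj m'j].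
split.
  by rewrite -mulnA Hm ?PoszM ?mulrA // (leq_trans mj) // leq_pmull.
by rewrite (mulnC p) -mulnA Hm' ?PoszM ?mulrA // (leq_trans m'j) // leq_pmull.
Qed.

Lemma eqlin_eventually (g h : nat -> int) (n0 : nat) :
  (forall n, (n0 <= n)%N -> g n = h n) -> eqlin g -> eqlin h.
Proof.
move=> gh [p p0 Hg]; exists p => // r; have [A [B [m Hm]]] := Hg r.
exists A, B, (maxn m n0) => j; rewrite geq_max => /andP[mj n0j].
by rewrite -gh ?Hm // (leq_trans n0j)// (leq_trans (leq_pmull j p0)) // leq_addl.
Qed.

Lemma eqlin_ext (g h : nat -> int) : g =1 h -> eqlin g -> eqlin h.
Proof. by move=> gh; apply: (@eqlin_eventually _ _ 0). Qed.

Lemma eqlin_cst (c : int) : eqlin (fun=> c).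
Proof. by exists 1%N => // r; exists 0, c, 0%N => j _; rewrite mul0r add0r. Qed.

Lemma eqlin_id : eqlin (fun n => n%:Z).
Proof.
by exists 1%N => // r; exists 1, r%:Z, 0%N => j _; rewrite mul1n mul1r addrC.
Qed.

Lemma eqlinD (g h : nat -> int) :
  eqlin g -> eqlin h -> eqlin (fun n => g n + h n).
Proof.
move=> Hg Hh; have [p p0 H] := eqlin_common Hg Hh; exists p => // r.
have [A [B [C [D [m Hm]]]]] := H r; exists (A + C), (B + D), m => j /Hm[-> ->].
by rewrite mulrDl addrACA.
Qed.

Lemma eqlinZ (c : int) (g : nat -> int) : eqlin g -> eqlin (fun n => c * g n).
Proof.
move=> [p p0 H]; exists p => // r; have [A [B [m Hm]]] := H r.
by exists (c * A), (c * B), m => j /Hm ->; rewrite mulrDr mulrA.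
Qed.

Lemma eqlinN (g : nat -> int) : eqlin g -> eqlin (fun n => - g n).
Proof. by move=> /(eqlinZ (-1)); apply: eqlin_ext => n; rewrite mulN1r. Qed.

Lemma eqlinB (g h : nat -> int) :
  eqlin g -> eqlin h -> eqlin (fun n => g n - h n).
Proof. by move=> Hg /eqlinN; apply: eqlinD. Qed.

(** On a residue class the sign of an affine function is eventually constant, so a single branch
    survives there. *)
Lemma eqlin_if (e g h : nat -> int) : eqlin e -> eqlin g -> eqlin h ->
  eqlin (fun n => if 0 <= e n then g n else h n).
Proof.
move=> He Hg Hh.
have sgn_e : exists2 p : nat, (0 < p)%N & forall r, exists (b : bool) (m0 : nat),
    forall j, (m0 <= j)%N -> (0 <= e (r + p * j)%N) = b.
  have [p p0 H] := He; exists p => // r; have [A [B [m Hm]]] := H r.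
  (* Past [|B|] a nonzero slope outweighs the constant term; the strict inequality for [A < 0] costs
     one more. *)
  case: (ltrgt0P A) => A0.
  - exists true, (m + `|B|)%N => j mj; rewrite Hm; last by lia.
    by nia.
  - exists false, (m + `|B|.+1)%N => j mj; rewrite Hm; last by lia.
    by nia.
  - by exists (0 <= B), m => j mj; rewrite Hm // A0 mul0r add0r.
have [p p0 Hp] := sgn_e.
have [q q0 Hq] := eqlin_common Hg Hh.
exists (p * q)%N; first by rewrite muln_gt0 p0.
move=> r; have [b [m Hm]] := Hp r; have [A [B [C [D [m' Hm']]]]] := Hq r.
exists (p%:Z * if b then A else C), (if b then B else D), (maxn m m') => j.
rewrite geq_max => /andP[mj m'j].
rewrite -{1}mulnA Hm ?(leq_trans mj) ?leq_pmull //.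
rewrite (mulnC p) -!mulnA.
have [-> ->] := Hm' (p * j)%N (leq_trans m'j (leq_pmull j p0)).
by rewrite PoszM; case: (b); ring.
Qed.

Lemma eqlin_max (g h : nat -> int) :
  eqlin g -> eqlin h -> eqlin (fun n => Num.max (g n) (h n)).
Proof.
move=> Hg Hh; have := eqlin_if (eqlinB Hg Hh) Hg Hh; apply: eqlin_ext => n.
by rewrite subr_ge0; case: leP.
Qed.

Lemma eqlin_min (g h : nat -> int) :
  eqlin g -> eqlin h -> eqlin (fun n => Num.min (g n) (h n)).
Proof.
move=> Hg Hh; have := eqlin_if (eqlinB Hg Hh) Hh Hg; apply: eqlin_ext => n.
by rewrite subr_ge0; case: leP.
Qed.

(** Refining the modulus by the factor [d] makes the slope divisible by [d], so the floor acts on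
    the constant term only. *)
Lemma eqlin_divz (d : int) (g : nat -> int) :
  0 < d -> eqlin g -> eqlin (fun n => (g n %/ d)%Z).
Proof.
case: d => // d d0 [p p0 H]; exists (p * d)%N; first by rewrite muln_gt0 p0.
move=> r; have [A [B [m Hm]]] := H r.
exists A, (B %/ d%:Z)%Z, m => j mj.
rewrite -mulnA Hm; last by rewrite (leq_trans mj) // leq_pmull.
by rewrite PoszM mulrCA mulrC divzMDl // lt0r_neq0.
Qed.

Lemma eqlin_sum (I : eqType) (s : seq I) (g : I -> nat -> int) :
  {in s, forall i, eqlin (g i)} -> eqlin (fun n => \sum_(i <- s) g i n).
Proof.
elim: s => [|i s IHs] Hs.
  by apply: eqlin_ext (eqlin_cst 0) => n; rewrite big_nil.
have Hi := Hs i (mem_head _ _).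
have /IHs {}IHs : {in s, forall i, eqlin (g i)}.
  by move=> j js; apply: Hs; rewrite inE js orbT.
by apply: eqlin_ext (eqlinD Hi IHs) => n; rewrite big_cons.
Qed.

(** The affine pieces, extended periodically to all integers, are the coefficients. Positivity of
    [g] keeps the leading coefficient nonzero when every slope vanishes and the degree drops to
    0. *)
Lemma eqlin_quasi_polynomial (R : realType) (g : nat -> nat) :
  (forall n, (0 < n)%N -> (0 < g n)%N) -> eqlin (fun n => (g n)%:Z) ->
  exists q : nat, (0 < q)%N /\
    exists (n p : nat) (f : int -> R),
      [/\ (n <= 1)%N, quasi_polynomial n p f, (p %| q)%N
        & forall k : nat, (q <= k)%N -> (g k)%:R = f k%:Z].
Proof.
move=> g_gt0 [p p0 H].
have [A HA] := choice H; have [B {}HA] := choice HA; have [m {}HA] := choice HA.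
pose M := (\max_(r < p) m r)%N.
pose res (k : int) := `|(k %% p%:Z)%Z|%N.
(* On the class of [r], substituting [k = r + p * j] turns [A * j + B] into
   [(A / p) * k + (B - (A / p) * r)]. *)
pose c1 k : R := (A (res k))%:~R / p%:R.
pose c0 k : R := (B (res k))%:~R - c1 k * (res k)%:R.
have per_res k : res (k + p%:Z) = res k by rewrite /res modzDr.
have per1 : periodic c1 p%:Z by move=> k; rewrite /c1 per_res.
have per0 : periodic c0 p%:Z by move=> k; rewrite /c0 per1 per_res.
have gE (k : nat) : (p * M.+1 <= k)%N -> (g k)%:R = c0 k + c1 k * k%:R.
  move=> Mk; have rk : res k = (k %% p)%N by rewrite /res modz_nat.
  rewrite /c0 -addrA [_ + c1 _ * _]addrC -mulrBr {1}(divn_eq k p) addnC mulnC.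
  have Mj : (m (k %% p)%N <= k %/ p)%N.
    apply: (@leq_trans M); last by rewrite leq_divRL // mulnC; lia.
    exact: (@leq_bigmax _ (fun r : 'I_p => m r) (Ordinal (ltn_pmod k p0))).
  rewrite [LHS]pmulrn (HA _ _ Mj).
  rewrite addrC rmorphD rmorphM /= /c1 rk -mulrA {5}(divn_eq k p). rewrite natrD addrK natrM.
  by rewrite -!pmulrn [p%:R^-1 * _]mulrC mulfK // pnatr_eq0 -lt0n.
have [n [c [n1 per [k ck] cE]]] : exists (n : nat) (c : 'I_n.+1 -> int -> R),
   [/\ (n <= 1)%N, common_period c p, exists k, c ord_max k <> 0 &
    forall k, \sum_(i < n.+1) c i k * k%:~R ^+ i = c0 k + c1 k * k%:~R].
  case: (pselect (exists k, c1 k <> 0)) => [Hc1|Hc1].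
    exists 1%N, (fun i => if i == ord0 then c0 else c1); split => //.
      by split=> // i; case: ifP.
    by move=> k; rewrite !big_ord_recl big_ord0 /= expr0 expr1 mulr1 addr0.
  have c10 k : c1 k = 0 by apply: contrapT => ?; apply: Hc1; exists k.
  exists 0%N, (fun=> c0); split => //; last first.
    by move=> k; rewrite big_ord1 expr0 mulr1 c10 mul0r addr0.
  (* All slopes vanish here, so a zero of [c0] beyond the thresholds would be a zero of [g]. *)
  exists (p * M.+1)%N => c00; have := gE (p * M.+1)%N (leqnn _).
  rewrite c00 c10 mul0r addr0 => /eqP; rewrite pnatr_eq0 eqn0Ngt.
  by rewrite g_gt0 // muln_gt0 p0.
have exper : exists p', `[< common_period c p' >] by exists p; apply/asboolP.
case: (ex_minnP exper) => p1 /asboolP[p10 per1'] minp1.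
(* This [q] lies past the thresholds of all classes and is a multiple of [p], hence of the least
   period. *)
exists (p * M.+1)%N; split; first by rewrite muln_gt0 p0.
exists n, p1, (fun k => \sum_(i < n.+1) c i k * k%:~R ^+ i); split => //.
- exists c; split => //; first by move=> p' ?; apply: minp1; apply/asboolP.
  by exists k.
(* The least period divides [p]: otherwise the remainder of [p] would be a smaller common period. *)
- apply: dvdn_mulr; rewrite /dvdn; apply: contraT; rewrite -lt0n => p2.
  have : (p1 <= p %% p1)%N.
    apply: minp1; apply/asboolP; split=> // i u.
    have -> : (p %% p1)%N%:Z = p%:Z - p1%:Z *+ (p %/ p1).
      by rewrite {2}(divn_eq p p1) PoszD PoszM -mulr_natl natz; ring.
    have per_n j w : c i (w - p1%:Z *+ j) = c i w.
      by elim: j => [|j IHj]; rewrite ?subr0 // -[LHS](per1' i) mulrSr opprD addrA subrK.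
    by rewrite addrA per_n; case: per => _; apply.
  by rewrite leqNgt ltn_pmod.
- by move=> j jM; rewrite cE gE.
Qed.

(** * Counting integers subject to linear inequalities *)

Notation ncard A := #|` fset_set A|.

Lemma ncard_image (T U : choiceType) (f : T -> U) (A : set T) :
  injective f -> finite_set A -> ncard (f @` A) = ncard A.
Proof. by move=> fI fA; rewrite fset_set_image // card_imfset. Qed.

Lemma ncard_bigcup (I : eqType) (T : choiceType) (s : seq I) (A : I -> set T) :
  uniq s -> {in s, forall i, finite_set (A i)} ->
  {in s &, forall i j, A i `&` A j !=set0 -> i = j} ->
  ncard (\bigcup_(i in [set` s]) A i) = (\sum_(i <- s) ncard (A i))%N.
Proof.
elim: s => [|i s IHs]/= => [_ _ _|/andP[i_s s_uniq] finA triv].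
  by rewrite set_nil bigcup_set0 fset_set0 cardfs0 big_nil.
have -> : [set` i :: s] = i |` [set` s].
  by apply/seteqP; split=> j /=; rewrite inE => /predU1P.
rewrite bigcup_setU1 big_cons fset_setU; last 2 first.
- by apply: finA; rewrite mem_head.
- by apply: bigcup_finite => // j js; apply: finA; rewrite inE js orbT.
rewrite cardfsU -fset_setI; last 2 first.
- by apply: finA; rewrite mem_head.
- by apply: bigcup_finite => // j js; apply: finA; rewrite inE js orbT.
rewrite (_ : _ `&` _ = set0) ?fset_set0 ?cardfs0 ?subn0 ?IHs //.
- by move=> j js; apply: finA; rewrite inE js orbT.
- by move=> j k js ks; apply: triv; rewrite inE ?js ?ks orbT.
apply/seteqP; split=> // x [Aix [j js Ajx]].
have ij : i = j by apply: triv; rewrite ?inE ?eqxx ?[j \in s]js ?orbT //; exists x.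
by move: i_s; rewrite ij => /negP; apply.
Qed.

Lemma finite_itvz (l h : int) : finite_set [set c : int | l <= c <= h].
Proof.
apply: (@sub_finite_set _ _ ((fun i : nat => l + i%:Z) @` `I_(`|h - l|.+1))).
  by move=> c /= lch; exists `|c - l|%N => /=; lia.
exact: finite_image.
Qed.

Lemma ncard_itvz (l h : int) : (ncard [set c : int | l <= c <= h])%:Z =
  if 0 <= h - l then h - l + 1 else 0.
Proof.
case: ifP => lh; last first.
  rewrite (_ : [set _ | _] = set0) ?fset_set0 ?cardfs0 //.
  by apply/seteqP; split=> c //= ?; lia.
rewrite (_ : [set _ | _] = (fun i : nat => l + i%:Z) @` `I_(`|h - l|.+1)).
  rewrite ncard_image; [|by move=> i j; lia|exact: finite_II].
  by rewrite (card_fset_set (n := `|h - l|.+1)) //; lia.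
apply/seteqP; split=> c /=; last by case=> i ? <-; lia.
by move=> lch; exists `|c - l|%N; lia.
Qed.

(** Induction on the family: the point found so far is raised to the new lower bound and then
    lowered to the new upper bound, and the pairwise hypothesis keeps the earlier bounds valid. An
    index may contribute both kinds of bound. *)
Lemma exists_between (T : realDomainType) (I : eqType) (s : seq I)
    (P Q : pred I) (f g : I -> T) :
  {in s &, forall i j, P i -> Q j -> f i <= g j} ->
  exists a, {in s, forall i, (P i -> f i <= a) /\ (Q i -> a <= g i)}.
Proof.
elim: s => [|i s IHs] fg; first by exists 0.
have [|a Ha] := IHs.
  by move=> j k js ks; apply: fg; rewrite inE ?js ?ks orbT.
have i_s : i \in i :: s by rewrite mem_head.
have in_s j : j \in s -> j \in i :: s by rewrite inE orbC => ->.
pose b := if P i then Num.max a (f i) else a.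
have Hb : {in s, forall j, (P j -> f j <= b) /\ (Q j -> b <= g j)}.
  move=> j js; have [Ha1 Ha2] := Ha j js; rewrite /b.
  case: ifP => // Pi; split=> [/Ha1 h|Qj]; first by rewrite le_max h.
  by rewrite ge_max Ha2 //= fg // in_s.
exists (if Q i then Num.min b (g i) else b) => j.
rewrite inE => /predU1P[->|js]; split.
- move=> Pi; have fb : f i <= b by rewrite /b Pi le_max lexx orbT.
  by case: ifP => // Qi; rewrite le_min fb fg.
- by move=> ->; rewrite ge_min lexx orbT.
- move=> Pj; case: ifP => Qi; last exact: (Hb j js).1.
  by rewrite le_min (Hb j js).1 //= fg // in_s.
- move=> Qj; case: ifP => Qi; last exact: (Hb j js).2.
  by rewrite ge_min (Hb j js).2.
Qed.

(** Integral Fourier-Motzkin elimination of [a]. A positive [al i] bounds [- a] above by a floor, a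
    negative one bounds [a] above by a floor; since these bounds are integers, pairwise
    compatibility already yields an integer in between. *)
Lemma exists_intP (I : eqType) (s : seq I) (al l : I -> int) :
  (exists a, {in s, forall i, 0 <= al i * a + l i}) <->
  {in s &, forall i j, (al i = 0 -> 0 <= l i) /\
    (0 < al i -> al j < 0 -> 0 <= (l i %/ al i)%Z + (l j %/ - al j)%Z)}.
Proof.
split=> [[a Ha] i j si sj|H].
  have := Ha i si; have := Ha j sj; split=> [ai0|ai0 aj0].
    by move: (Ha i si); rewrite ai0 mul0r add0r.
  have : - a <= (l i %/ al i)%Z by rewrite lez_divRL //; lia.
  have : a <= (l j %/ - al j)%Z by rewrite lez_divRL //; lia.
  by lia.
have [|a Ha] := @exists_between int I s (fun i => 0 < al i) (fun i => al i < 0)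
  (fun i => - (l i %/ al i)%Z) (fun i => (l i %/ - al i)%Z).
  by move=> i j si sj Pi Qj; have := (H i j si sj).2 Pi Qj; lia.
exists a => i si; have [H1 H2] := Ha i si.
case: (ltrgt0P (al i)) => ai.
- have : - a <= (l i %/ al i)%Z by have := H1 ai; lia.
  by rewrite lez_divRL //; lia.
- by have := H2 ai; rewrite lez_divRL //; lia.
- by rewrite ai mul0r add0r (H i i si si).1.
Qed.

(** Induction on the constraints: one with [b i] nonzero is absorbed into [lo] or [hi] through a
    floor, one with [b i = 0] becomes a condition on [n] alone. An interval remains at the end. *)
Lemma eqlin_count1 (I : eqType) (s : seq I) (b : I -> int) (e : I -> nat -> int)
    (lo hi : nat -> int) :
  {in s, forall i, eqlin (e i)} -> eqlin lo -> eqlin hi ->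
  eqlin (fun n => (ncard [set c : int | lo n <= c <= hi n /\
                     {in s, forall i, 0 <= b i * c + e i n}])%:Z).
Proof.
elim: s lo hi => [|i s IHs] lo hi es Elo Ehi.
  have := eqlin_if (eqlinB Ehi Elo)
    (eqlinD (eqlinB Ehi Elo) (eqlin_cst 1)) (eqlin_cst 0).
  apply: eqlin_ext => n; rewrite -ncard_itvz; congr (ncard _)%:Z.
  by apply/seteqP; split => c //= [].
have ei := es i (mem_head _ _).
have {}IHs := IHs _ _ (fun j js => es j (mem_behead (s := i :: s) js)).
case: (ltrgt0P (b i)) => bi.
- have E := eqlin_max Elo (eqlinN (eqlin_divz bi ei)).
  apply: eqlin_ext (IHs _ _ E Ehi) => n; congr (ncard _)%:Z.
  have divP c : (- (e i n %/ b i)%Z <= c) = (0 <= b i * c + e i n).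
    by rewrite lerNl lez_divRL //; lia.
  apply/seteqP; split => c /=; rewrite ge_max divP.
    move=> [/andP[/andP[-> h2] ->] h]; split=> // j.
    by rewrite inE => /predU1P[->//|/h].
  move=> [/andP[-> ->] h]; rewrite h ?mem_head //; split=> // j js.
  by apply: h; rewrite inE js orbT.
- have bi' : 0 < - b i by lia.
  have E := eqlin_min Ehi (eqlin_divz bi' ei).
  apply: eqlin_ext (IHs _ _ Elo E) => n; congr (ncard _)%:Z.
  have divP c : (c <= (e i n %/ - b i)%Z) = (0 <= b i * c + e i n).
    by rewrite lez_divRL //; lia.
  apply/seteqP; split => c /=; rewrite le_min divP.
    move=> [/andP[h1 /andP[h2 h3]] h]; rewrite h1 h2; split=> // j.
    by rewrite inE => /predU1P[->//|/h].
  move=> [/andP[-> ->] h]; rewrite h ?mem_head //; split=> // j js.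
  by apply: h; rewrite inE js orbT.
- have E := eqlin_if ei (IHs _ _ Elo Ehi) (eqlin_cst 0).
  apply: eqlin_ext E => n; case: ifP => ein.
    congr (ncard _)%:Z; apply/seteqP; split => c /= [h1 h]; split=> //.
      by move=> j; rewrite inE => /predU1P[->|/h//]; rewrite bi mul0r add0r.
    by move=> j js; apply: h; rewrite inE js orbT.
  rewrite (_ : [set _ | _] = set0) ?fset_set0 ?cardfs0 //.
  apply/seteqP; split => c //= [_ /(_ i (mem_head _ _))].
  by rewrite bi mul0r add0r ein.
Qed.

(** Eliminating [a] produces floors that are not affine in [c]. They become affine once [c] is
    restricted to a residue class modulo a common multiple [N] of the nonzero [|al i|]; the count on
    each class is then one-dimensional. *)
Lemma eqlin_count2 (I : eqType) (s : seq I) (al be : I -> int)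
    (e : I -> nat -> int) (lo hi : nat -> int) :
  {in s, forall i, eqlin (e i)} -> eqlin lo -> eqlin hi ->
  eqlin (fun n => (ncard [set c : int | lo n <= c <= hi n /\
     exists a, {in s, forall i, 0 <= al i * a + (be i * c + e i n)}])%:Z).
Proof.
move=> es Elo Ehi.
(* The value 1 for a vanishing coefficient keeps the product [N] positive. *)
pose m i := if al i == 0 then 1 else `|al i|%N%:Z.
have m_gt0 i : 0 < m i by rewrite /m; case: eqP => //; lia.
pose N := \prod_(i <- s) m i.
have N_gt0 : 0 < N by exact: prodr_gt0.
have mN i : i \in s -> (N %/ m i)%Z * m i = N.
  by move=> si; rewrite divzK // /N (big_rem i si) /= dvdz_mulr.
pose S r n : set int := [set c : int | lo n <= N * c + r%:Z <= hi n /\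
   exists a, {in s, forall i, 0 <= al i * a + (be i * (N * c + r%:Z) + e i n)}].
have S_fin r n : finite_set (S r n).
  apply: sub_finite_set (finite_itvz (- (- (lo n - r%:Z) %/ N)%Z)
    ((hi n - r%:Z) %/ N)%Z) => c /= [/andP[h1 h2] _].
  by rewrite lerNl !lez_divRL //; lia.
have S_eqlin r : eqlin (fun n => (ncard (S r n))%:Z).
  pose k i := be i * (N %/ m i)%Z.
  pose f i n := ((be i * r%:Z + e i n) %/ m i)%Z.
  (* One affine constraint per ordered pair of indices; pairs whose signs impose nothing give the
     trivial [0 <= 0]. *)
  pose b2 (ij : I * I) := if al ij.1 == 0 then be ij.1 * N else
     if (0 < al ij.1) && (al ij.2 < 0) then k ij.1 + k ij.2 else 0.
  pose e2 (ij : I * I) n := if al ij.1 == 0 then be ij.1 * r%:Z + e ij.1 n else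
     if (0 < al ij.1) && (al ij.2 < 0) then f ij.1 n + f ij.2 n else 0.
  have Ef i : i \in s -> eqlin (f i).
    by move=> si; apply: eqlin_divz => //; apply: eqlinD; [exact: eqlin_cst|exact: es].
  have fE i c n : i \in s ->
      ((be i * (N * c + r%:Z) + e i n) %/ m i)%Z = k i * c + f i n.
    move=> si; rewrite -divzMDl ?gt_eqF // -{1}(mN i si) /k; congr divz; ring.
  have E : {in allpairs pair s s, forall ij, eqlin (e2 ij)}.
    move=> _ /allpairsP[[i j] /= [si sj ->]]; rewrite /e2 /=.
    case: (al i == 0); first by apply: eqlinD; [exact: eqlin_cst|exact: es].
    case: (_ && _); last exact: eqlin_cst.
    by apply: eqlinD; exact: Ef.
  have Elo' : eqlin (fun n => - (- (lo n - r%:Z) %/ N)%Z).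
    by apply/eqlinN/eqlin_divz/eqlinN/eqlinB => //; exact: eqlin_cst.
  have Ehi' : eqlin (fun n => ((hi n - r%:Z) %/ N)%Z).
    by apply/eqlin_divz/eqlinB => //; exact: eqlin_cst.
  apply: eqlin_ext (eqlin_count1 b2 E Elo' Ehi') => n; congr (ncard _)%:Z.
  have bndE c : (- (- (lo n - r%:Z) %/ N)%Z <= c <= ((hi n - r%:Z) %/ N)%Z) =
      (lo n <= N * c + r%:Z <= hi n).
    by rewrite lerNl !lez_divRL //; congr andb; lia.
  have pairE i j c : i \in s -> j \in s -> let l i := be i * (N * c + r%:Z) + e i n in
      0 <= b2 (i, j) * c + e2 (i, j) n <-> (al i = 0 -> 0 <= l i) /\
      (0 < al i -> al j < 0 -> 0 <= (l i %/ al i)%Z + (l j %/ - al j)%Z).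
    move=> si sj l; have := fE i c n si; have := fE j c n sj.
    rewrite /b2 /e2 /m /l /=; case: (eqVneq (al i) 0) => [ai|ai].
      by move=> _ _; rewrite ai ltxx mulrDr !mulrA addrA; split=> [|[->//]].
    case: (ltP 0 (al i)) => ai' /=; last first.
      by move=> _ _; rewrite mul0r addr0; split=> // _; split=> // /eqP; rewrite (negPf ai).
    case: (ltP (al j) 0) => aj /=; last first.
      by move=> _ _; rewrite mul0r addr0; split=> // _; split=> // /eqP; rewrite (negPf ai).
    rewrite lt_eqF // => fj fi; have -> : al i = `|al i|%N by lia.
    have -> : - al j = `|al j|%N by lia.
    rewrite fi fj addrACA mulrDl; split=> [h|[_]]; last by apply; lia.
    by split=> //; lia.
  rewrite /S; apply/seteqP; split => c /=; rewrite bndE => -[-> h]; split=> //.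
    apply/exists_intP => i j si sj; apply/pairE => //.
    by apply: h; apply/allpairsP; exists (i, j).
  move=> _ /allpairsP[[i j] /= [si sj ->]]; apply/pairE => //.
  by move/exists_intP : h; exact.
have := eqlin_sum (s := iota 0 `|N|) (fun r _ => S_eqlin r).
apply: eqlin_ext => n.
(* The set to be counted is the disjoint union, over the residues [r] below [N], of the images of
   [S r n]. *)
pose emb (r : nat) (c : int) := N * c + r%:Z.
have emb_inj r : injective (emb r).
  by move=> c c' /addIr /mulfI -> //; rewrite gt_eqF.
rewrite (_ : [set _ | _] = \bigcup_(r in [set` iota 0 `|N|]) (emb r @` S r n)).
  rewrite ncard_bigcup ?iota_uniq //.
  - rewrite (big_morph Posz PoszD (erefl _)); apply: eq_bigr => r _.
    by rewrite ncard_image.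
  - by move=> r _; exact: finite_image.
  - move=> r r'; rewrite !mem_iota /= => rN r'N [_ [[c _ <-] [c' _ /eqP]]].
    have modE x (t : nat) : (t < `|N|)%N -> ((emb t x) %% N)%Z = t.
      by move=> tN; rewrite /emb mulrC modzMDl modz_small //; lia.
    by move=> /eqP/(congr1 (fun z => (z %% N)%Z)); rewrite !modE // => -[].
apply/seteqP; split => c /=; last by case=> r _ [c' ? <-].
move=> [c1 c2]; exists `|(c %% N)%Z|%N.
  by rewrite /= mem_iota; have := ltz_pmod c N_gt0; have := modz_ge0 c (lt0r_neq0 N_gt0); lia.
have cE : N * (c %/ N)%Z + `|(c %% N)%Z|%N = c.
  by rewrite gez0_abs ?modz_ge0 ?gt_eqF // mulrC -divz_eq.
by exists (c %/ N)%Z; rewrite /emb /S /= ?cE.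
Qed.

(** * Homogenised convex hulls and their extreme points *)

Section Cones.
Variables (R : realType) (n : nat).
Implicit Types (V W : seq 'rV[R]_n) (x y v : 'rV[R]_n) (s t a : R).

Lemma convex_setP (A : set 'rV[R]_n) : convex_set A <->
  forall x y t, 0 <= t <= 1 -> A x -> A y -> A (t *: x + (1 - t) *: y).
Proof.
split=> [cA x y t /andP[t0 t1] Ax Ay|cA x y t /set_mem Ax /set_mem Ay].
  by have /set_mem := cA x y (Itv01 t0 t1) (mem_set Ax) (mem_set Ay).
by apply/mem_set/cA => //; apply/andP.
Qed.

(* The pair [(x, s)] lies in the convex cone generated by [V * {1}]; the dilate
   by [s > 0] of the convex hull of [V] is the slice at height [s]. *)
Fixpoint cone V x s : Prop :=
  if V is v :: W then exists2 l, 0 <= l & cone W (x - l *: v) (s - l)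
  else x = 0 /\ s = 0.

Lemma cone_ge0 V x s : cone V x s -> 0 <= s.
Proof.
elim: V x s => [|v V IHV] x s /=; first by case=> _ ->.
by move=> [l l0 /IHV]; lra.
Qed.

Lemma cone_eq0 V x : cone V x 0 -> x = 0.
Proof.
elim: V x => [|v V IHV] x /=; first by case.
move=> [l l0 h]; have := cone_ge0 h => h1; have l00 : l = 0 by lra.
by move: h; rewrite l00 scale0r !subr0; exact: IHV.
Qed.

Lemma coneZ V x s a : 0 <= a -> cone V x s -> cone V (a *: x) (a * s).
Proof.
move=> a0; elim: V x s => [|v V IHV] x s /=.
  by move=> [-> ->]; rewrite scaler0 mulr0.
move=> [l l0 /IHV h]; exists (a * l); first exact: mulr_ge0.
by rewrite -scalerA -scalerBr -mulrBr.
Qed.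

Lemma coneD V x y s t : cone V x s -> cone V y t -> cone V (x + y) (s + t).
Proof.
elim: V x y s t => [|v V IHV] x y s t /=.
  by move=> [-> ->] [-> ->]; rewrite !addr0.
move=> [l l0 hx] [m m0 hy]; exists (l + m); first exact: addr_ge0.
by rewrite scalerDl !opprD addrACA [in X in cone _ _ X]addrACA; exact: IHV.
Qed.

Lemma cone00 V : cone V 0 0.
Proof. by elim: V => //= v V IHV; exists 0; rewrite ?scale0r ?subr0. Qed.

Lemma cone_mem V v : v \in V -> cone V v 1.
Proof.
elim: V => // w V IHV; rewrite inE => /predU1P[->|/IHV h] /=.
  by exists 1; rewrite // scale1r !subrr; exact: cone00.
by exists 0; rewrite ?scale0r ?subr0.
Qed.

Lemma cone_trans V W x s :
  {in W, forall w, cone V w 1} -> cone W x s -> cone V x s.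
Proof.
elim: W x s => [|w W IHW] x s WV /=; first by case=> -> ->; exact: cone00.
move=> [l l0 /IHW h]; rewrite -(subrK (l *: w) x) -(subrK l s).
apply: coneD; first by apply: h => u uW; apply: WV; rewrite inE uW orbT.
by rewrite -{2}(mulr1 l); apply: coneZ => //; apply: WV; rewrite mem_head.
Qed.

Lemma cone_le V W x s : {subset W <= V} -> cone W x s -> cone V x s.
Proof. by move=> WV; apply: cone_trans => w /WV /cone_mem. Qed.

Lemma cone_conv V x y t :
  0 <= t <= 1 -> cone V x 1 -> cone V y 1 -> cone V (t *: x + (1 - t) *: y) 1.
Proof.
move=> /andP[t0]; rewrite -subr_ge0 => t1 Vx Vy.
have := coneD (coneZ t0 Vx) (coneZ t1 Vy).
by rewrite (_ : t * 1 + (1 - t) * 1 = 1) //; ring.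
Qed.

(** Peeling off the first generator writes the normalised point as a convex combination, with weight
    [l / s], of [v] and the normalised remainder; a remainder of height 0 is the zero vector and is
    treated apart. *)
Lemma convex_cone (C : set 'rV[R]_n) V x s : convex_set C ->
  {in V, forall v, C v} -> 0 < s -> cone V x s -> C (s^-1 *: x).
Proof.
move=> /convex_setP cC; elim: V x s => [|v V IHV] x s CV s0 /=.
  by move=> [_ h]; move: s0; rewrite h ltxx.
move=> [l l0 h]; have Cv : C v by apply: CV; rewrite mem_head.
have CV' : {in V, forall v, C v} by move=> u uV; apply: CV; rewrite inE uV orbT.
have := cone_ge0 h; rewrite le_eqVlt => /predU1P[/esym sl|sl].
  move: h; rewrite sl => /cone_eq0/eqP; rewrite subr_eq0 => /eqP ->.
  have <- : s = l by lra.
  by rewrite scalerA mulVf ?scale1r // gt_eqF.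
have Ch := IHV _ _ CV' sl h.
have h01 : 0 <= l / s <= 1.
  by rewrite divr_ge0 ?(ltW s0) //= ler_pdivrMr // mul1r; lra.
have := cC _ _ _ h01 Cv Ch; congr C.
by apply/rowP => i; rewrite !mxE; field; rewrite !gt_eqF.
Qed.

Lemma conv_hull_cone V : conv_hull [set` V] = [set x | cone V x 1].
Proof.
apply/seteqP; split=> x; last first.
  move=> Vx A [cA VA]; have := convex_cone cA VA ltr01 Vx.
  by rewrite invr1 scale1r.
move=> /(_ [set x | cone V x 1]); apply; split; last by move=> v /= /cone_mem.
by apply/convex_setP => y z t t01; exact: cone_conv.
Qed.

(* A generating family without redundant points consists of extreme points. *)
Lemma exists_vertices (s : seq 'rV[R]_n) : exists V,
  conv_hull [set` V] = conv_hull [set` s] /\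
  {in V, forall v, vertex (conv_hull [set` V]) v}.
Proof.
have [m] := ubnP (size s); elim: m s => // m IHm s sm.
case: (pselect (exists2 v, v \in s & cone (rem v s) v 1)) => [[v vs cv]|nc].
  have [|V [VE Vv]] := IHm (rem v s).
    by rewrite size_rem //; case: s sm vs {cv} => // *; rewrite -ltnS.
  exists V; split=> //; rewrite VE !conv_hull_cone; apply/seteqP; split=> x /=.
    by apply: cone_le => u; exact: mem_rem.
  apply: cone_trans => u us; have [->//|uv] := eqVneq u v; apply: cone_mem.
  by move: us; rewrite (perm_mem (perm_to_rem vs)) inE (negPf uv).
exists s; split=> // v vs; rewrite conv_hull_cone; split; first exact: cone_mem.
move=> y z t /= ys zs /andP[t0 t1] vE.
have split_v x : cone s x 1 -> cone (v :: rem v s) x 1.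
  by apply: cone_le => u; rewrite (perm_mem (perm_to_rem vs)).
have [a a0 ya] := split_v _ ys; have [b b0 zb] := split_v _ zs.
have t1' : 0 <= 1 - t by lra.
have := coneD (coneZ t1' ya) (coneZ (ltW t0) zb).
(* [c] is the total weight of [v] in this representation of [v] itself. If [c < 1], then [v] is
   generated by the other points, against irredundancy; if [c = 1], then [a = b = 1] and both [y]
   and [z] equal [v]. *)
set c := (1 - t) * a + t * b.
have -> : (1 - t) *: (y - a *: v) + t *: (z - b *: v) = (1 - c) *: v.
  rewrite [X in _ = _ *: X]vE {1 2}vE; apply/rowP => i; rewrite !mxE /c; ring.
have -> : (1 - t) * (1 - a) + t * (1 - b) = 1 - c by rewrite /c; ring.
move=> hc; have := cone_ge0 hc; rewrite le_eqVlt => /predU1P[c1|c1]; last first.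
  case: nc; exists v => //; have c1' : 0 <= (1 - c)^-1 by rewrite invr_ge0 ltW.
  by have := coneZ c1' hc; rewrite scalerA !mulVf ?scale1r // gt_eqF.
have := cone_ge0 ya; have := cone_ge0 zb => hb ha.
have a1 : a = 1 by move: c1; rewrite /c; nra.
have b1 : b = 1 by move: c1; rewrite /c; nra.
move: ya zb; rewrite a1 b1 !subrr !scale1r => /cone_eq0/eqP + /cone_eq0/eqP.
by rewrite !subr_eq0 => /eqP -> /eqP ->.
Qed.

End Cones.

(** * Half-plane descriptions and chords of planar polygons *)

Section Plane.
Variable R : realType.
Implicit Types (V W : seq 'rV[R]_2) (x y u v d p q : 'rV[R]_2).
Implicit Types (s t a b c : R) (z w : int * int) (f g : int * int * int).

Local Notation px x := (x ord0 ord0).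
Local Notation py x := (x ord0 ord_max).

Lemma rV2P x y : px x = px y -> py x = py y -> x = y.
Proof.
move=> h0 h1; apply/rowP => -[[|[|//]] i]; [move: h0|move: h1];
  by congr (x _ _ = y _ _); exact: val_inj.
Qed.

Definition vec z : 'rV[R]_2 := \row_j (if j == ord0 then z.1 else z.2)%:~R.

(** The last coefficient multiplies the height [s], so one integral form describes the corresponding
    half-plane for all dilates at once. *)
Definition functional f x s := f.1.1%:~R * px x + f.1.2%:~R * py x + f.2%:~R * s.

Definition eval f z (k : int) : int := f.1.1 * z.1 + f.1.2 * z.2 + f.2 * k.

Lemma functionalE f z k : functional f (vec z) k%:~R = (eval f z k)%:~R.
Proof. by rewrite /functional /eval !mxE /= !rmorphD !rmorphM. Qed.

Lemma functionalB f v x s l :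
  functional f (x - l *: v) (s - l) = functional f x s - l * functional f v 1.
Proof. by rewrite /functional !mxE; ring. Qed.

(* Fourier-Motzkin: the coefficient of the generator [v] is eliminated. *)
Lemma cone_halfspaces (V : seq (int * int)) : exists F : seq (int * int * int),
  forall x s, cone (map vec V) x s <-> {in F, forall f, 0 <= functional f x s}.
Proof.
elim: V => [|v V [F FP]] /=.
  (* Both signs of each of the three coordinates cut out the origin, the cone without generators. *)
  exists [:: (1, 0, 0); (-1, 0, 0); (0, 1, 0); (0, -1, 0); (0, 0, 1); (0, 0, -1)].
  move=> x s; split=> [[-> ->] f _|H].
    by rewrite /functional !mxE !mulr0 !addr0.
  set F := [:: _; _; _; _; _; _] in H.
  have h (i : 'I_6) : 0 <= functional (nth (0, 0, 0) F i) x s.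
    by apply/H/mem_nth/ltn_ord.
  have := (h (inord 0), h (inord 1), h (inord 2), h (inord 3), h (inord 4), h (inord 5)).
  rewrite /functional !inordK //= => -[[[[[h0 h1] h2] h3] h4] h5].
  by split; last lra; apply: rV2P; rewrite mxE; lra.
pose e f := eval f v 1.
have eE f : functional f (vec v) 1 = (e f)%:~R by rewrite -functionalE.
(* This combination vanishes on the generator [v], so it is insensitive to the coefficient being
   eliminated. *)
pose comb f g : int * int * int := (- e g * f.1.1 + e f * g.1.1,
  - e g * f.1.2 + e f * g.1.2, - e g * f.2 + e f * g.2).
have combE f g x s : functional (comb f g) x s =
    - (e g)%:~R * functional f x s + (e f)%:~R * functional g x s.
  rewrite /functional /comb /=; move: (e f) (e g) => a b.
  by rewrite !rmorphD !rmorphM !rmorphN /=; ring.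
exists ([seq f <- F | 0 <= e f] ++
  [seq comb f g | f <- [seq f <- F | 0 < e f], g <- [seq g <- F | e g < 0]]).
move=> x s; split.
  move=> [l l0 /FP H] f; rewrite mem_cat => /orP[|].
    rewrite mem_filter => /andP[ef /H]; rewrite functionalB eE.
    have : 0 <= (e f)%:~R :> R by rewrite ler0z.
    by nra.
  move=> /allpairsP[[f1 f2] /= [+ + ->]]; rewrite !mem_filter.
  move=> /andP[ef1 /H h1] /andP[ef2 /H h2]; rewrite combE.
  move: h1 h2; rewrite !functionalB !eE.
  have : 0 < (e f1)%:~R :> R by rewrite ltr0z.
  have : (e f2)%:~R < 0 :> R by rewrite ltrz0.
  by nra.
move=> H.
(* [None] stands for the constraint [0 <= l], a lower bound with value 0. *)
pose val (o : option (int * int * int)) :=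
  if o is Some f then functional f x s / (e f)%:~R else 0 : R.
have [|l Hl] := @exists_between R (option (int * int * int)) (None :: map some F)
    (fun o => if o is Some f then e f < 0 else true)
    (fun o => if o is Some f then 0 < e f else false) val val.
  move=> [f|] [g|] //=; rewrite !inE /= !(mem_map (@Some_inj _)) => fF gF.
    move=> ef eg; have : 0 <= functional (comb g f) x s.
      apply: H; rewrite mem_cat; apply/orP; right; apply/allpairsP; exists (g, f).
      by rewrite !mem_filter ef eg fF gF.
    rewrite combE ler_pdivlMr ?ltr0z // mulrAC ler_ndivrMr ?ltrz0 //.
    by nra.
  move=> _ eg; apply: divr_ge0; last by rewrite ler0z ltW.
  by apply: H; rewrite mem_cat mem_filter gF ltW.
exists l; first by have := (Hl None (mem_head _ _)).1 isT.
apply/FP => f fF; have := Hl (Some f).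
rewrite inE /= (mem_map (@Some_inj _)) fF functionalB eE => /(_ isT)[h1 h2].
case: (ltrgt0P (e f)) => ef.
- by have := h2 ef; rewrite ler_pdivlMr ?ltr0z // subr_ge0.
- by have := h1 ef; rewrite ler_ndivrMr ?ltrz0 // subr_ge0.
- by rewrite ef mulr0 subr0; apply: H; rewrite mem_cat mem_filter ef lexx fF.
Qed.

Lemma cone_height V a b m x s :
  {in V, forall v, m <= a * px v + b * py v} ->
  cone V x s -> m * s <= a * px x + b * py x.
Proof.
elim: V x s => [|v V IHV] x s HV /=.
  by move=> [-> ->]; rewrite !mxE !mulr0 addr0.
move=> [l l0 /IHV h]; have := h (fun u uV => HV u (mem_behead (s := v :: V) uV)).
have := HV v (mem_head _ _); rewrite !mxE; nra.
Qed.

(** Its level sets are the lines parallel to [d], so it measures the height of [x] transversally to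
    [d]. *)
Definition det d x := px d * py x - py d * px x.

Lemma det0_colinear d x : d != 0 -> det d x = 0 -> exists t, x = t *: d.
Proof.
move=> d0; rewrite /det => dx.
have n0 : px d * px d + py d * py d != 0.
  apply: contraNneq d0 => h; apply/eqP/rV2P; rewrite mxE; nra.
(* The coefficient of the orthogonal projection of [x] onto [d]. *)
exists ((px d * px x + py d * py x) / (px d * px d + py d * py d)).
apply: rV2P; rewrite mxE; apply: (mulIf n0); rewrite mulrAC divfK //.
  have : py d * (px d * py x - py d * px x) = 0 by rewrite dx mulr0.
  by lra.
have : px d * (px d * py x - py d * px x) = 0 by rewrite dx mulr0.
by lra.
Qed.

(** Each generator is assigned to the side of the strip on which it lies. [V] stays fixed while the
    induction shrinks [W]. *)
Lemma cone_split V W d c1 c2 x s :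
  {subset W <= V} -> {in W, forall v, det d v <= c1 \/ c2 <= det d v} ->
  cone W x s -> exists x1 s1, [/\ cone V x1 s1, cone V (x - x1) (s - s1),
    det d x1 <= c1 * s1 & c2 * (s - s1) <= det d (x - x1)].
Proof.
elim: W x s => [|w W IHW] x s WV HW /=.
  move=> [-> ->]; exists 0, 0; rewrite !subr0.
  by split; rewrite ?mulr0 //; [exact: cone00..| |]; rewrite /det !mxE; lra.
move=> [l l0 /IHW [|u uW|x1 [s1 [h1 h2 h3 h4]]]].
- by move=> u uW; apply: WV; rewrite inE uW orbT.
- by apply: HW; rewrite inE uW orbT.
have wV : cone V (l *: w) l.
  by rewrite -[X in cone _ _ X]mulr1; apply/coneZ/cone_mem/WV/mem_head.
case: (HW w (mem_head _ _)) => hw.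
  exists (x1 + l *: w), (s1 + l); rewrite !opprD.
  rewrite [in cone V (x + _)](addrC (- x1)) [in cone V _ (s + _)](addrC (- s1)).
  rewrite !addrA; split=> //; first exact: coneD.
    by move: hw h3; rewrite /det !mxE; nra.
  by move: h4; rewrite /det !mxE; lra.
exists x1, s1; split=> //; last by move: hw h4; rewrite /det !mxE; nra.
by have := coneD h2 wV; rewrite addrAC subrK addrAC subrK.
Qed.

(** With no generator strictly between the heights [c1] and [c2], a slice of the polygon in between
    is the weighted Minkowski sum of the two extreme slices. Remixing the two parts of a split point
    brings them exactly to those heights. *)
Lemma cone_slices V d c1 c2 x :
  {in V, forall v, det d v <= c1 \/ c2 <= det d v} ->
  c1 < det d x < c2 -> cone V x 1 ->
  let t := (det d x - c1) / (c2 - c1) in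
  exists p q, [/\ cone V p (1 - t), cone V q t, det d p = c1 * (1 - t),
                  det d q = c2 * t & x = p + q].
Proof.
move=> HV /andP[c1x xc2] Vx t.
have [y [s [Vy Vxy hy hxy]]] := cone_split (fun _ => id) HV Vx.
have s0 := cone_ge0 Vy; have s1 := cone_ge0 Vxy.
have hB : det d (x - y) = det d x - det d y by rewrite /det !mxE; ring.
rewrite hB in hxy.
set hx := det d x in c1x xc2 hxy t hB *; set h := det d y in hy hxy hB.
(* The [a] measure the excess of the two parts over [c1], the [b] their deficit below [c2]. The
   weights [al] and [be] solve the linear system that gives the first mixture no excess over [c1]
   and the complementary one no deficit below [c2]. *)
pose a1 := h - c1 * s; pose a2 := (hx - h) - c1 * (1 - s).
pose b1 := c2 * s - h; pose b2 := c2 * (1 - s) - (hx - h).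
have a10 : a1 <= 0 by rewrite /a1; lra.
have b20 : b2 <= 0 by rewrite /b2; lra.
have aa : 0 < a1 + a2 by rewrite /a1 /a2; lra.
have bb : 0 < b1 + b2 by rewrite /b1 /b2; lra.
have D0 : 0 < a2 * b1 - a1 * b2 by nra.
pose al := a2 * (b1 + b2) / (a2 * b1 - a1 * b2).
pose be := - a1 * (b1 + b2) / (a2 * b1 - a1 * b2).
have al0 : 0 <= al by rewrite divr_ge0 ?(ltW D0) // mulr_ge0 //; lra.
have be0 : 0 <= be by rewrite divr_ge0 ?(ltW D0) // mulr_ge0 //; lra.
have al1 : 0 <= 1 - al by rewrite subr_ge0 ler_pdivrMr //; nra.
have be1 : 0 <= 1 - be by rewrite subr_ge0 ler_pdivrMr //; nra.
have Dne : a2 * b1 - a1 * b2 != 0 by rewrite gt_eqF.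
have e1 : al * a1 + be * a2 = 0 by rewrite /al /be; field.
have e2 : (1 - al) * b1 + (1 - be) * b2 = 0 by rewrite /al /be; field.
have cc : c2 - c1 != 0 by rewrite gt_eqF //; lra.
pose sq := (1 - al) * s + (1 - be) * (1 - s).
have tE : t = sq.
  apply: (mulIf cc); rewrite /t divfK //.
  move: e1 e2; rewrite /a1 /a2 /b1 /b2 /sq; lra.
have t1E : 1 - t = al * s + be * (1 - s) by rewrite tE /sq; ring.
exists (al *: y + be *: (x - y)), ((1 - al) *: y + (1 - be) *: (x - y)).
rewrite t1E tE; split.
- by apply: coneD; apply: coneZ.
- by apply: coneD; apply: coneZ.
- have -> : det d (al *: y + be *: (x - y)) = al * h + be * (hx - h).
    by rewrite /h /hx /det !mxE; ring.
  by move: e1; rewrite /a1 /a2; lra.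
- have -> : det d ((1 - al) *: y + (1 - be) *: (x - y)) =
      (1 - al) * h + (1 - be) * (hx - h) by rewrite /h /hx /det !mxE; ring.
  by move: e2; rewrite /b1 /b2 /sq; lra.
- by apply/rowP => i; rewrite !mxE; ring.
Qed.

Lemma exists_argmax (T : eqType) (r : seq T) (h : T -> R) : r != [::] ->
  exists2 m, m \in r & {in r, forall i, h i <= h m}.
Proof.
elim: r => // i [|j r] IHr _.
  by exists i; rewrite ?mem_head // => k; rewrite inE => /eqP ->.
have [m mr hm] := IHr isT; case: (leP (h m) (h i)) => mi.
  exists i; rewrite ?mem_head // => k; rewrite inE => /predU1P[->//|/hm kr].
  exact: le_trans mi.
exists m; first by rewrite inE mr orbT.
by move=> k; rewrite inE => /predU1P[->|/hm//]; exact: ltW.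
Qed.

Definition vertices_of V := {in V, forall v, vertex (conv_hull [set` V]) v}.

(** A vertex on the line of a chord cannot lie strictly inside it, so it lies at or beyond one end;
    the opposite end of the chord is then at distance at least [t] from it. *)
Lemma chord_through_vertex V d x u t : d != 0 -> vertices_of V -> u \in V ->
  0 < t -> cone V x 1 -> cone V (x + t *: d) 1 -> det d x = det d u ->
  exists2 t', t <= t' & cone V (u + t' *: d) 1 \/ cone V (u - t' *: d) 1.
Proof.
move=> d0 VV uV t0 Vx Vy xu.
have [|r ur] := @det0_colinear d (u - x) d0.
  by move: xu; rewrite /det !mxE; lra.
have uE : u = x + r *: d by rewrite -ur subrKC.
case: (leP r 0) => r0.
  exists (t - r); first by lra.
  by left; rewrite uE -addrA -scalerDl subrKC.
case: (leP t r) => rt.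
  by exists r => //; right; rewrite uE addrK.
have [_ /(_ x (x + t *: d) (r / t))] := VV u uV.
rewrite conv_hull_cone => /(_ Vx Vy) [].
- by rewrite divr_gt0 //= ltr_pdivrMr // mul1r.
- by rewrite uE; apply/rowP => i; rewrite !mxE; field; rewrite gt_eqF.
move=> xu_ xtu; have /eqP : t *: d = 0 by apply: (addrI x); rewrite addr0 xtu.
rewrite scaler_eq0 (negPf d0) orbF.
by rewrite gt_eqF.
Qed.

(** The sliding argument: unless a vertex already lies on the line of the chord, [t] is a weighted
    mean of the lengths of two parallel chords at the neighbouring vertex heights, and one of these
    is at least [t]. *)
Lemma chord_le_vertex_chord V d x t : d != 0 -> vertices_of V -> 0 < t ->
  cone V x 1 -> cone V (x + t *: d) 1 ->
  exists u t', [/\ u \in V, t <= t' &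
    cone V (u + t' *: d) 1 \/ cone V (u - t' *: d) 1].
Proof.
move=> d0 VV t0 Vx Vy.
have detDZ y r : det d (y + r *: d) = det d y by rewrite /det !mxE; ring.
have V0 : V != [::].
  by case: V Vx {VV Vy} => //= -[_ /eqP]; rewrite oner_eq0.
case: (pselect (exists2 u, u \in V & det d x = det d u)) => [[u uV xu]|nV].
  have [t' tt' h] := chord_through_vertex d0 VV uV t0 Vx Vy xu.
  by exists u, t'.
pose c := det d x.
have V_ne u : u \in V -> det d u != c.
  by move=> uV; apply/eqP => h; apply: nV; exists u.
(* A point of the hull cannot lie below every vertex, and none has height [c], so some vertex is
   strictly lower; symmetrically for higher. *)
have lo_ne : [seq v <- V | det d v < c] != [::].
  apply/eqP => h; have [m mV Hm] := exists_argmax (fun v => - det d v) V0.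
  have := @cone_height V (- py d) (px d) (det d m) x 1.
  rewrite (_ : _ + _ = c) => [|]; last by rewrite /c /det; ring.
  rewrite mulr1 => /(_ _ Vx) -mc.
  have : m \in [seq v <- V | det d v < c].
    rewrite mem_filter mV andbT lt_neqAle V_ne //= mc // => v /Hm.
    by rewrite /det; lra.
  by rewrite h.
have hi_ne : [seq v <- V | c < det d v] != [::].
  apply/eqP => h; have [m mV Hm] := exists_argmax (fun v => det d v) V0.
  have := @cone_height V (py d) (- px d) (- det d m) x 1.
  rewrite (_ : _ + _ = - c) => [|]; last by rewrite /c /det; ring.
  rewrite mulr1 lerN2 => /(_ _ Vx) -mc.
  have : m \in [seq v <- V | c < det d v].
    rewrite mem_filter mV andbT lt_neqAle eq_sym V_ne //= mc // => v /Hm.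
    by rewrite /det; lra.
  by rewrite h.
(* [u1] and [u2] have the heights nearest to [c] from below and above, so no vertex lies strictly
   between them. *)
have [u1 + Hu1] := exists_argmax (fun v => det d v) lo_ne.
have [u2 + Hu2] := exists_argmax (fun v => - det d v) hi_ne.
rewrite !mem_filter => /andP[cu2 u2V] /andP[u1c u1V].
have HV : {in V, forall v, det d v <= det d u1 \/ det d u2 <= det d v}.
  move=> v vV; case: (ltgtP (det d v) c) => vc; last by have := V_ne v vV; rewrite vc eqxx.
    by left; apply: Hu1; rewrite mem_filter vc.
  by right; rewrite -lerN2; apply: Hu2; rewrite mem_filter vc.
have bx : det d u1 < det d x < det d u2 by rewrite u1c.
have bxt : det d u1 < det d (x + t *: d) < det d u2 by rewrite detDZ.
have [p [q [Vp Vq hp hq xE]]] := cone_slices HV bx Vx.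
have := cone_slices HV bxt Vy; rewrite detDZ.
set r := (det d x - det d u1) / (det d u2 - det d u1) in Vp Vq hp hq *.
move=> [p' [q' [Vp' Vq' hp' hq' yE]]].
have r0 : 0 < r by rewrite divr_gt0 //; move: bx => /andP[]; lra.
have r1 : 0 < 1 - r.
  by rewrite subr_gt0 ltr_pdivrMr; move: bx => /andP[]; lra.
have [|a pE] := @det0_colinear d (p' - p) d0.
  by move: hp hp'; rewrite /det !mxE; lra.
have [|b qE] := @det0_colinear d (q' - q) d0.
  by move: hq hq'; rewrite /det !mxE; lra.
have tE : t = a + b.
  have /eqP : (t - (a + b)) *: d = 0.
    by rewrite scalerBl scalerDl -pE -qE addrACA -opprD -yE -xE addrC addKr subrr.
  by rewrite scaler_eq0 (negPf d0) orbF subr_eq0 => /eqP.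
have norm y s : 0 < s -> cone V y s -> cone V (s^-1 *: y) 1.
  move=> s0 /(coneZ (ltW (etrans (invr_gt0 s) s0))).
  by rewrite mulVf // gt_eqF.
have chord_at y y' s e (w : 'rV[R]_2) : w \in V -> 0 < s -> cone V y s -> cone V y' s ->
    det d y = det d w * s -> y' - y = e *: d -> t * s <= e ->
    exists u t', [/\ u \in V, t <= t' &
      cone V (u + t' *: d) 1 \/ cone V (u - t' *: d) 1].
  move=> uV s0 Vy1 Vy1' hy yy' tc.
  have tcs : t <= e / s by rewrite ler_pdivlMr.
  have cs0 : 0 < e / s by apply: lt_le_trans tcs.
  have Vy2 : cone V (s^-1 *: y + (e / s) *: d) 1.
    by rewrite mulrC -scalerA -yy' -scalerDr addrC subrK; exact: norm.
  have hy2 : det d (s^-1 *: y) = det d w.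
    have -> : det d (s^-1 *: y) = s^-1 * det d y by rewrite /det !mxE; ring.
    by rewrite hy mulrCA mulVf ?mulr1 // gt_eqF.
  have [t' tt' h] := chord_through_vertex d0 VV uV cs0 (norm _ _ s0 Vy1) Vy2 hy2.
  by exists w, t'; split=> //; exact: le_trans tt'.
(* The rescaled chords have lengths [a / (1 - r)] and [b / r]; as [a + b = t], both cannot be
   smaller than [t]. *)
case: (leP (t * r) b) => [hb|hb]; first exact: (chord_at q q' r b u2).
by apply: (chord_at p p' (1 - r) a u1) => //; lra.
Qed.

End Plane.

(** * Primitive directions, lattice segments and rational rays *)

Section Lattice.
Variable R : realType.
Implicit Types (V : seq (int * int)) (x y : 'rV[R]_2) (s t : R).
Implicit Types (z w u d e : int * int) (f : int * int * int).

Local Notation px x := (x ord0 ord0).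
Local Notation py x := (x ord0 ord_max).
Local Notation vec := (@vec R).
Local Notation Z2 := (@Z2 R).

Definition shift z (a : int) d : int * int := (z.1 + a * d.1, z.2 + a * d.2).

Definition detz d z : int := d.1 * z.2 - d.2 * z.1.

Lemma vec_shift z a d : vec (shift z a d) = vec z + a%:~R *: vec d.
Proof. by apply: rV2P; rewrite !mxE /= rmorphD rmorphM. Qed.

Lemma det_vec d z : det (vec d) (vec z) = (detz d z)%:~R.
Proof. by rewrite /det /detz !mxE /= rmorphB !rmorphM. Qed.

Lemma vec_inj : injective vec.
Proof.
move=> [z1 z2] [w1 w2] h.
have := (congr1 (fun x : 'rV_2 => px x) h, congr1 (fun x : 'rV_2 => py x) h).
by rewrite !mxE /= => -[/intr_inj -> /intr_inj ->].
Qed.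

Lemma Z2P x : Z2 x <-> exists z, x = vec z.
Proof.
split=> [H|[z ->] i]; last by rewrite mxE intr_int.
have /intrP[a ha] := H ord0; have /intrP[b hb] := H ord_max.
by exists (a, b); apply: rV2P; rewrite !mxE.
Qed.

Lemma bezout_dir d : coprimez d.1 d.2 -> exists e, detz d e = 1.
Proof.
case: (Bezoutz d.1 d.2) => a [b h] /eqP cd; exists (- b, a).
by rewrite /detz /= -cd -h; ring.
Qed.

Lemma primitive_neq0 d : coprimez d.1 d.2 -> vec d != 0.
Proof.
move=> /bezout_dir[e de]; apply/eqP => d0.
have := det_vec d e; rewrite de d0 /det !mxE !mul0r subrr => /eqP.
by rewrite eq_sym oner_eq0.
Qed.

Lemma primitive_opp d : coprimez d.1 d.2 -> coprimez (- d.1) (- d.2).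
Proof. by rewrite coprimezN coprimeNz. Qed.

Lemma exists_primitive z w : z <> w -> exists (g : int) d,
  [/\ 0 < g, coprimez d.1 d.2 & w = shift z g d].
Proof.
move=> zw; pose g := gcdz (w.1 - z.1) (w.2 - z.2).
have g0 : 0 < g.
  rewrite lt_neqAle eq_sym gcdz_eq0 andbT; apply/negP => /andP[/eqP h1 /eqP h2].
  by apply: zw; rewrite (surjective_pairing z) (surjective_pairing w); congr pair; lia.
exists g, (((w.1 - z.1) %/ g)%Z, ((w.2 - z.2) %/ g)%Z); split=> //=.
  apply/coprimezP; have [a [b h]] := Bezoutz (w.1 - z.1) (w.2 - z.2).
  exists (a, b); apply: (mulIf (lt0r_neq0 g0)).
  by rewrite /= mulrDl -!mulrA !divzK ?dvdz_gcdl ?dvdz_gcdr // h mul1r.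
rewrite /shift [g * _]mulrC [g * (_ %/ _)%Z]mulrC !divzK ?dvdz_gcdl ?dvdz_gcdr //.
by rewrite !subrKC -surjective_pairing.
Qed.

(** For primitive [d] the lattice points of the segment are exactly the [g + 1] points [z + i d]. *)
Lemma segment_length_shift z (g : nat) d : coprimez d.1 d.2 ->
  segment_length (vec z) (vec (shift z g%:Z d)) = g%:R.
Proof.
move=> cd; have [e de] := bezout_dir cd.
rewrite /segment_length; set A := _ `&` _.
have -> : A = (fun i : nat => vec (shift z i%:Z d)) @` `I_g.+1.
  have conv_cone : conv_hull [set vec z; vec (shift z g%:Z d)] =
      [set x | cone [:: vec z; vec (shift z g%:Z d)] x 1].
    rewrite -conv_hull_cone; congr conv_hull; apply/seteqP; split=> x /=.
      by rewrite !inE => -[->|->]; rewrite eqxx ?orbT.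
    by rewrite !inE => /orP[/eqP ->|/eqP ->]; [left|right].
  rewrite /A conv_cone; apply/seteqP; split => x /=.
    move=> [[l l0 [m m0 [xE lm]]] /Z2P[w xw]].
    have wE : vec w = vec z + (m * g%:R) *: vec d.
      have xE' : x = l *: vec z + m *: vec (shift z g%:Z d).
        by apply/eqP; rewrite -subr_eq0 opprD addrA xE.
      rewrite -xw xE' vec_shift (_ : l = 1 - m); last by lra.
      by apply/rowP => j; rewrite !mxE; ring.
    (* As [detz d e = 1], the determinant against [e] reads off the coefficient of [d], which is
       therefore an integer. *)
    pose i := detz (w.1 - z.1, w.2 - z.2) e.
    have iE : i%:~R = m * g%:R :> R.
      have := congr1 (fun y => det y (vec e)) wE.
      have -> : det (vec w) (vec e) = det (vec z) (vec e) + i%:~R.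
        by rewrite !det_vec /i /detz -rmorphD /=; congr intr; ring.
      have -> : det (vec z + (m * g%:R) *: vec d) (vec e) =
          det (vec z) (vec e) + m * g%:R * (detz d e)%:~R.
        by rewrite -det_vec /det !mxE; ring.
      by rewrite de mulr1 => /addrI.
    have i0 : 0 <= i by rewrite -(ler0z R) iE mulr_ge0.
    have ig : i <= g%:Z.
      by rewrite -(ler_int R) iE ler_piMl // -?pmulrn //; lra.
    have ig' : (`|i| < g.+1)%N by lia.
    exists `|i|%N => //.
    by rewrite vec_shift gez0_abs // iE -wE xw.
  move=> [i ig <-]; split; last by apply/Z2P; eexists.
  (* For [g = 0] the quotient is 0 by convention, which is right since then [i = 0]. *)
  pose m : R := i%:R / g%:R.
  have mg : m * g%:R = i%:R.
    rewrite /m; case: (posnP g) ig => [->|g0 _]; last by rewrite divfK // pnatr_eq0 -lt0n.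
    by rewrite ltnS leqn0 => /eqP ->; rewrite mulr0.
  have m01 : 0 <= m <= 1.
    rewrite divr_ge0 //= /m; case: (posnP g) ig => [->|g0 ig].
      by rewrite invr0 mulr0.
    by rewrite ler_pdivrMr ?ltr0n // mul1r ler_nat -ltnS.
  exists (1 - m); first by lra.
  exists m; first by lra.
  split; last by ring.
  by rewrite !vec_shift; apply/rowP => j; rewrite !mxE -!pmulrn -mg; ring.
rewrite ncard_image; last exact: finite_II.
  by rewrite (card_fset_set (n := g.+1)) // -natr1 addrK.
move=> i j /vec_inj; rewrite /shift => -[h1 h2].
suff : (i%:Z - j%:Z) * detz d e = 0 by rewrite de; lia.
have -> : (i%:Z - j%:Z) * detz d e =
  (z.1 + i%:Z * d.1 - (z.1 + j%:Z * d.1)) * e.2 -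
  (z.2 + i%:Z * d.2 - (z.2 + j%:Z * d.2)) * e.1 by rewrite /detz; ring.
by rewrite h1 h2 !subrr !mul0r.
Qed.

Lemma cone_segment (V : seq 'rV[R]_2) x y s t a : 0 <= s <= t ->
  cone V x a -> cone V (x + t *: y) a -> cone V (x + s *: y) a.
Proof.
move=> /andP[s0 st] Vx Vy; have [t0|t0] := eqVneq t 0.
  have -> : s = 0 by move: st; rewrite t0; lra.
  by rewrite scale0r addr0.
have t_gt0 : 0 < t by rewrite lt0r t0 (le_trans s0).
have h1 : 0 <= s / t by rewrite divr_ge0 // ltW.
have h2 : 0 <= 1 - s / t by rewrite subr_ge0 ler_pdivrMr // mul1r.
have := coneD (coneZ h2 Vx) (coneZ h1 Vy).
have -> : (1 - s / t) * a + s / t * a = a by ring.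
suff -> : (1 - s / t) *: x + (s / t) *: (x + t *: y) = x + s *: y by [].
by apply/rowP => j; rewrite !mxE; field.
Qed.

(** A pair [(a, b)] encodes the constraint [0 <= a + t * b] along a ray. Either no constraint ever
    fails for [t >= 0], or the first to fail, the one with largest [a / b] among negative [b], gives
    a rational exit time. *)
Lemma ray_max (T : seq (int * int)) : {in T, forall ab, 0 <= ab.1} ->
  {in T, forall ab, 0 <= ab.2} \/
  exists N D : int, [/\ 0 <= N, 0 < D,
    {in T, forall ab, 0 <= ab.1%:~R + N%:~R / D%:~R * ab.2%:~R :> R} &
    forall t, {in T, forall ab, 0 <= ab.1%:~R + t * ab.2%:~R} -> t <= N%:~R / D%:~R].
Proof.
move=> T0; case: (eqVneq [seq ab <- T | ab.2 < 0] [::]) => [h|/exists_argmax].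
  left => ab abT; rewrite leNgt; apply/negP => ab2.
  have : ab \in [seq ab <- T | ab.2 < 0] by rewrite mem_filter ab2.
  by rewrite h.
move=> /(_ R (fun ab => ab.1%:~R / ab.2%:~R)) [[N D]].
rewrite mem_filter /= => /andP[D0 NDT] Hmax; right.
have D0' : 0 < - D%:~R :> R by rewrite oppr_gt0 ltrz0.
exists N, (- D); rewrite rmorphN; split; [exact: (T0 _ NDT)|by lia| |].
  move=> [a b] abT /=; case: (leP 0 b) => b0.
    have N0 := T0 _ NDT; have a0 := T0 _ abT.
    apply: addr_ge0; first by rewrite ler0z.
    by apply: mulr_ge0; rewrite ?ler0z //; apply: divr_ge0; rewrite ?ler0z // ltW.
  have := Hmax (a, b); rewrite mem_filter b0 abT /= => /(_ isT).
  by rewrite ler_ndivrMr ?ltrz0 // invrN mulrN mulNr subr_ge0.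
move=> t /(_ _ NDT) /= h; rewrite ler_pdivlMr //; lra.
Qed.

Definition bound V : int := \sum_(v <- V) (`|v.1| + `|v.2|).

Lemma cone_bound V x s : cone (map vec V) x s ->
  `|px x| <= (bound V)%:~R * s /\ `|py x| <= (bound V)%:~R * s.
Proof.
rewrite /bound; elim: V x s => [|v V IHV] x s /=.
  by move=> [-> ->]; rewrite !mxE normr0 mulr0.
move=> [l l0 /[dup] /cone_ge0 sl /IHV]; rewrite big_cons.
set b := \sum_(_ <- _) _; rewrite !mxE => -[h1 h2].
have b0 : 0 <= b%:~R :> R by rewrite ler0z sumr_ge0 // => ? _; rewrite addr_ge0.
have hx : `|px x| <= `|px x - l * v.1%:~R| + l * `|v.1%:~R|.
  by have := ler_normD (px x - l * v.1%:~R) (l * v.1%:~R); rewrite subrK normrM (ger0_norm l0).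
have hy : `|py x| <= `|py x - l * v.2%:~R| + l * `|v.2%:~R|.
  by have := ler_normD (py x - l * v.2%:~R) (l * v.2%:~R); rewrite subrK normrM (ger0_norm l0).
rewrite !rmorphD /= -!intr_norm in hx hy *.
have n1 : 0 <= `|v.1|%:~R :> R by rewrite ler0z.
have n2 : 0 <= `|v.2|%:~R :> R by rewrite ler0z.
by split; nra.
Qed.

End Lattice.

(** * The longest chord and the lattice diameter of the dilates *)

Section Diameter.
Variable R : realType.
Implicit Types (V : seq (int * int)) (x y : 'rV[R]_2) (s t : R).
Implicit Types (z w u d e : int * int) (f : int * int * int).

Local Notation vec := (@vec R).

Lemma chord_bound V x d s t : cone (map vec V) x s ->
  cone (map vec V) (x + t *: vec d) s ->
  t * `|d.1|%:~R <= 2 * (bound V)%:~R * s /\ t * `|d.2|%:~R <= 2 * (bound V)%:~R * s.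
Proof.
move=> /cone_bound[x1 x2] /cone_bound[]; rewrite !mxE /= => y1 y2.
have tri (a b c : R) : `|a| <= b -> `|a + t * c| <= b -> t * `|c| <= 2 * b.
  move=> ab abc; have := ler_normB (a + t * c) a; rewrite addrC addKr normrM.
  by have := ler_norm t; have := normr_ge0 c; nra.
rewrite !intr_norm -!mulrA; split; [apply: tri x1 y1|apply: tri x2 y2].
Qed.

Definition box (b : int) : seq (int * int) :=
  let r := [seq i%:Z - b | i <- iota 0 `|b + b|.+1] in
  [seq d <- allpairs pair r r | coprimez d.1 d.2].

Lemma mem_box b d : 0 <= b ->
  (d \in box b) = [&& coprimez d.1 d.2, `|d.1| <= b & `|d.2| <= b].
Proof.
move=> b0; rewrite mem_filter; congr andb.
set r := [seq _ | i <- _].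
have mem_r (i : int) : (i \in r) = (`|i| <= b).
  apply/mapP/idP => [[j]|ib]; first by rewrite mem_iota => /andP[_ jb] ->; lia.
  exists `|(i + b)%R|%N; last by lia.
  by rewrite mem_iota; apply/andP; split; lia.
case: d => d1 d2; apply/allpairsP/andP => [[[i j] [/= + + [-> ->]]]|[h1 h2]].
  by rewrite !mem_r.
by exists (d1, d2); rewrite /= !mem_r h1 h2.
Qed.

(** The integral half-planes restrict to rational constraints on the ray, and boundedness of the
    polygon rules out a ray that never leaves. *)
Lemma ray_in_polygon V u d : vec u \in map vec V -> coprimez d.1 d.2 ->
  exists N D : int, [/\ 0 < D, cone (map vec V) (vec u + (N%:~R / D%:~R) *: vec d) 1 &
    forall t, cone (map vec V) (vec u + t *: vec d) 1 -> t <= N%:~R / D%:~R].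
Proof.
move=> uV cd; have [F FP] := cone_halfspaces R V.
have fE f t : functional f (vec u + t *: vec d) 1 = (eval f u 1)%:~R + t * (eval f d 0)%:~R.
  by rewrite -!functionalE /functional !mxE; ring.
pose T := [seq (eval f u 1, eval f d 0) | f <- F].
have T0 : {in T, forall ab, 0 <= ab.1}.
  move=> _ /mapP[f fF ->] /=; rewrite -(ler0z R) -functionalE.
  by have /FP := cone_mem uV; exact.
case: (ray_max R T0) => [Td|[N [D [N0 D0 H1 H2]]]]; last first.
  exists N, D; split=> //.
    by apply/FP => f fF; rewrite fE; apply: (H1 (_, _)); apply: map_f.
  move=> t /FP H; apply: H2 => _ /mapP[f fF ->] /=.
  by rewrite -fE; exact: H.
(* Just beyond the length permitted by [chord_bound], since a primitive [d] has a coordinate of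
   absolute value at least 1. *)
pose t : R := 2 * (bound V)%:~R + 1.
have b0 : 0 <= (bound V)%:~R :> R.
  by have [h _] := cone_bound (cone_mem uV); move: h; rewrite mulr1; exact: le_trans.
have /(chord_bound (cone_mem uV)) : cone (map vec V) (vec u + t *: vec d) 1.
  apply/FP => f fF; rewrite fE addr_ge0 ?ler0z ?(T0 (_, _) (map_f _ fF)) //.
  by rewrite mulr_ge0 ?ler0z ?(Td (_, _) (map_f _ fF)) // /t; lra.
have d_ne0 : (1 <= `|d.1|) || (1 <= `|d.2|).
  have := primitive_neq0 R cd; apply: contraR; rewrite negb_or => /andP[h1 h2].
  by apply/eqP/rV2P; rewrite !mxE /=; apply/eqP; rewrite intr_eq0; lia.
have t0 : 0 < t by rewrite /t; lra.
have tP (a : int) : 1 <= `|a| -> t * `|a|%:~R <= 2 * (bound V)%:~R * 1 -> False.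
  rewrite -(ler_int R) mulr1 => a1 /(le_trans (ler_peMr (ltW t0) a1)).
  by rewrite /t; lra.
by case/orP: d_ne0 => h [h1 h2]; exfalso; [exact: tP h1|exact: tP h2].
Qed.

(** Two distinct integral vertices are joined by a chord of length at least 1, so shorter chords are
    irrelevant; longer ones have primitive directions in a fixed box. The maximum is thus over a
    finite list of vertices and directions. *)
Lemma lattice_chord_max V u1 u2 : u1 \in V -> u2 \in V -> u1 <> u2 ->
  exists N D : int, [/\ 0 < D, D <= N,
    exists u d, [/\ u \in V, coprimez d.1 d.2 &
      cone (map vec V) (vec u + (N%:~R / D%:~R) *: vec d) 1] &
    forall u d t, u \in V -> coprimez d.1 d.2 ->
      cone (map vec V) (vec u + t *: vec d) 1 -> t <= N%:~R / D%:~R].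
Proof.
move=> u1V u2V u12; have [g [d0 [g0 cd0 u2E]]] := exists_primitive u12.
have vecV u : u \in V -> vec u \in map vec V by exact: map_f.
(* A dummy value for irrelevant pairs makes the relation total, as [choice] requires. *)
have H (ud : (int * int) * (int * int)) : exists ND : int * int,
    ud.1 \in V -> coprimez ud.2.1 ud.2.2 -> [/\ 0 < ND.2,
      cone (map vec V) (vec ud.1 + (ND.1%:~R / ND.2%:~R) *: vec ud.2) 1 &
      forall t, cone (map vec V) (vec ud.1 + t *: vec ud.2) 1 -> t <= ND.1%:~R / ND.2%:~R].
  case: (pselect (ud.1 \in V /\ coprimez ud.2.1 ud.2.2)) => [[uV cd]|h].
    by have [N [D h]] := ray_in_polygon (vecV _ uV) cd; exists (N, D).
  by exists (0, 0) => ? ?; case: h.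
have [ND {}H] := choice H.
have b0 : 0 <= bound V by rewrite sumr_ge0 // => v _; rewrite addr_ge0.
pose cand := [seq (u, d) | u <- V, d <- box (2 * bound V)].
have g1 : 1 <= g%:~R :> R by rewrite (ler_int R 1); lia.
have g_chord : cone (map vec V) (vec u1 + g%:~R *: vec d0) 1.
  by rewrite -vec_shift -u2E; apply: cone_mem; exact: vecV.
have d_box u d t : u \in V -> 1 <= t -> coprimez d.1 d.2 ->
    cone (map vec V) (vec u + t *: vec d) 1 -> d \in box (2 * bound V).
  move=> uV t1 cd /(chord_bound (cone_mem (vecV _ uV))) [h1 h2].
  rewrite mem_box ?cd; last by lia.
  rewrite -!(ler_int R) !rmorphM /=.
  have n1 : 0 <= `|d.1|%:~R :> R by rewrite ler0z.
  have n2 : 0 <= `|d.2|%:~R :> R by rewrite ler0z.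
  by apply/andP; split; nra.
have cand1 : (u1, d0) \in cand by apply: allpairs_f => //; exact: d_box g_chord.
have cand0 : cand != [::] by apply/eqP => h; rewrite h in cand1.
have [[u d] + Hmax] := exists_argmax (fun ud => (ND ud).1%:~R / (ND ud).2%:~R : R) cand0.
case/allpairsP => -[u' d'] /= [uV' + [uu' dd']]; subst u' d'.
rewrite mem_box; last by lia.
case/andP => cd _.
have [D0 Vchord _] := H (u, d) uV' cd.
have L1 : g%:~R <= (ND (u, d)).1%:~R / (ND (u, d)).2%:~R :> R.
  apply: le_trans (Hmax _ cand1); have [_ _] := H (u1, d0) u1V cd0; exact.
exists (ND (u, d)).1, (ND (u, d)).2; split=> //.
- have := le_trans g1 L1; rewrite ler_pdivlMr ?ltr0z // mul1r ler_int //.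
- by exists u, d.
move=> w e t wV ce Vt; case: (leP 1 t) => t1; last first.
  by apply: le_trans (le_trans g1 L1); exact: ltW.
apply: le_trans (Hmax (w, e) _); last by apply: allpairs_f => //; exact: d_box Vt.
by have [_ _] := H (w, e) wV ce; exact.
Qed.

Lemma coneZ_gt0 (V : seq 'rV[R]_2) x s t : 0 < t ->
  cone V (t *: x) (t * s) <-> cone V x s.
Proof.
move=> t0; split=> [h|]; last exact: coneZ (ltW t0).
have t0' : 0 <= t^-1 by rewrite invr_ge0 ltW.
by have := coneZ t0' h; rewrite scalerA mulrA mulVf ?gt_eqF // scale1r mul1r.
Qed.

(** The witness is the floor of [k * N / D]. It is attained from the lattice point [k u] with [u] an
    end of a longest chord; conversely a lattice chord, scaled by [1 / k], is no longer than some
    chord from a vertex. *)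
Lemma lattice_chord_length V u1 u2 : vertices_of (map vec V) ->
  u1 \in V -> u2 \in V -> u1 <> u2 ->
  exists D : nat -> int, [/\ eqlin D, forall k, k%:Z <= D k &
    forall k, (0 < k)%N ->
    (exists z d, [/\ coprimez d.1 d.2, cone (map vec V) (vec z) k%:R &
      cone (map vec V) (vec (shift z (D k) d)) k%:R]) /\
    forall z d g, coprimez d.1 d.2 -> cone (map vec V) (vec z) k%:R ->
      cone (map vec V) (vec (shift z g d)) k%:R -> g <= D k].
Proof.
move=> VV u1V u2V u12; have [N [D [D0 DN [u [d [uV cd Vu]]] Nmax]]] :=
  lattice_chord_max u1V u2V u12.
have D0' : 0 < D%:~R :> R by rewrite ltr0z.
exists (fun k => (N * k%:Z %/ D)%Z); split.
- by apply: eqlin_divz => //; apply: eqlinZ; exact: eqlin_id.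
- by move=> k; rewrite lez_divRL // mulrC ler_wpM2r.
move=> k k0; have k0' : 0 < k%:R :> R by rewrite ltr0n.
split.
  exists (shift (0, 0) k%:Z u), d; split=> //.
    rewrite vec_shift (_ : vec (0, 0) = 0); last by apply: rV2P; rewrite !mxE.
    rewrite add0r -pmulrn -[X in cone _ _ X]mulr1.
    by apply/(coneZ_gt0 _ _ _ k0')/cone_mem/map_f.
  rewrite !vec_shift (_ : vec (0, 0) = 0); last by apply: rV2P; rewrite !mxE.
  rewrite add0r -pmulrn.
  apply: (@cone_segment _ _ _ _ _ (k%:R * (N%:~R / D%:~R))).
  - rewrite ler0z divz_ge0 // mulr_ge0 //=; last by lia.
    rewrite mulrA ler_pdivlMr // -intrM mulrC -[k%:R]/(k%:Z%:~R) -intrM ler_int.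
    by rewrite [D * _]mulrC [k%:Z * _]mulrC lez_floor ?gt_eqF.
  - by rewrite -[X in cone _ _ X]mulr1; apply/(coneZ_gt0 _ _ _ k0')/cone_mem/map_f.
  - rewrite -scalerA -scalerDr -[X in cone _ _ X]mulr1.
    by apply/(coneZ_gt0 _ _ _ k0').
move=> z e g ce Vz; rewrite vec_shift => Vzg.
rewrite lez_divRL //; case: (leP g 0) => g0.
  by apply: (@le_trans _ _ 0); [nia|apply: mulr_ge0; lia].
have [k1 k2] : k%:R * 1 = k%:R :> R /\ k%:R != 0 :> R by rewrite mulr1 gt_eqF.
pose t : R := g%:~R / k%:R.
have t0 : 0 < t by rewrite divr_gt0 // ltr0z.
have Vz1 : cone (map vec V) (k%:R^-1 *: vec z) 1.
  by apply/(coneZ_gt0 _ _ _ k0'); rewrite scalerA mulfV // scale1r k1.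
have Vz2 : cone (map vec V) (k%:R^-1 *: vec z + t *: vec e) 1.
  apply/(coneZ_gt0 _ _ _ k0'); rewrite scalerDr !scalerA mulfV // scale1r k1.
  by rewrite /t mulrC divfK.
have [_ [t' [/mapP[w wV ->] tt' H]]] :=
  chord_le_vertex_chord (primitive_neq0 R ce) VV t0 Vz1 Vz2.
have tL : t <= N%:~R / D%:~R.
  apply: le_trans tt' _; case: H => [|H]; first exact: Nmax.
  (* A chord running backwards from the vertex is a chord in the opposite direction, again
     primitive. *)
  apply: (Nmax w (- e.1, - e.2)); rewrite ?primitive_opp //=.
  suff -> : vec (- e.1, - e.2) = - vec e by rewrite scalerN.
  by apply: rV2P; rewrite !mxE /= rmorphN.
move: tL; rewrite /t ler_pdivlMr // mulrAC ler_pdivrMr //.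
by rewrite -[k%:R]/(k%:Z%:~R) -!intrM ler_int.
Qed.

End Diameter.

(** * Counting diameter lines by direction and height *)

Section DiameterLines.
Variable R : realType.
Implicit Types (V : seq (int * int)) (x y : 'rV[R]_2) (s t : R) (k : nat).
Implicit Types (z w u d e : int * int) (f : int * int * int).

Local Notation vec := (@vec R).
Local Notation Z2 := (@Z2 R).
Local Notation hull V := (conv_hull [set` map vec V]).

Lemma dilate_cone V k x : (0 < k)%N ->
  dilate k (hull V) x <-> cone (map vec V) x k%:R.
Proof.
move=> k0; have k0' : 0 < k%:R :> R by rewrite ltr0n.
rewrite /dilate conv_hull_cone; split=> [[y Vy <-]|Vx].
  by rewrite -[X in cone _ _ X]mulr1; apply/coneZ_gt0.
exists (k%:R^-1 *: x) => /=; last by rewrite scalerA mulfV ?gt_eqF // scale1r.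
apply/(coneZ_gt0 _ _ _ k0').
by rewrite scalerA mulfV ?gt_eqF // scale1r mulr1.
Qed.

Lemma segment_length_primitive z (g : int) d : 0 <= g -> coprimez d.1 d.2 ->
  segment_length (vec z) (vec (shift z g d)) = g%:~R.
Proof. by case: g => // g _ cd; rewrite segment_length_shift. Qed.

Lemma vec_shift_neq z (g : int) d : 0 < g -> coprimez d.1 d.2 ->
  vec z <> vec (shift z g d).
Proof.
move=> g0 cd; rewrite vec_shift -[X in X <> _]addr0 => /addrI/esym/eqP.
rewrite scaler_eq0 (negPf (primitive_neq0 R cd)) orbF intr_eq0.
by rewrite gt_eqF.
Qed.

Definition line d (c : int) : set 'rV[R]_2 := [set x | det (vec d) x = c%:~R].

Lemma aff_hull_line z (g : int) d : 0 < g -> coprimez d.1 d.2 ->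
  aff_hull [set vec z; vec (shift z g d)] = line d (detz d z).
Proof.
move=> g0 cd; have g0' : g%:~R != 0 :> R by rewrite intr_eq0 gt_eqF.
have detS x t : det (vec d) (x + t *: vec d) = det (vec d) x.
  by rewrite /det !mxE; ring.
apply/seteqP; split.
  apply: smallest_sub => [x y t|x] /=; rewrite /line /=.
    move=> xd yd; have -> : det (vec d) ((1 - t) *: x + t *: y) =
        (1 - t) * det (vec d) x + t * det (vec d) y by rewrite /det !mxE; ring.
    by rewrite xd yd; ring.
  by move=> [->|->]; rewrite ?vec_shift ?detS det_vec.
move=> x xd A [affA zA].
have [|t tE] := @det0_colinear R (vec d) (x - vec z) (primitive_neq0 R cd).
  by move: xd; rewrite /line /= -det_vec /det !mxE; lra.
have := affA _ _ (t / g%:~R) (zA _ (or_introl erefl)) (zA _ (or_intror erefl)).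
congr A; rewrite -(subrKC (vec z) x) tE vec_shift.
by apply/rowP => i; rewrite !mxE; field.
Qed.

(* Selects one of the two opposite primitive directions of a line. *)
Definition normal d := (0 < d.1) || (d.1 == 0) && (0 < d.2).

Lemma normal_or_opp d : coprimez d.1 d.2 -> normal d \/ normal (- d.1, - d.2).
Proof.
move=> /bezout_dir[e]; rewrite /normal /detz /= => de.
case: (ltgtP d.1 0) => h1; rewrite ?oppr_gt0 ?oppr_eq0 ?h1; [by right|by left|].
rewrite h1 mul0r sub0r in de; rewrite eqxx /=.
by case: (ltgtP d.2 0) => h2; [right|left|exfalso]; rewrite ?ltxx //=; lia.
Qed.

(** Bezout partners show [d' = a d] with [a] a unit of the integers, and normality excludes
    [a = -1]. *)
Lemma colinear_normal d d' : coprimez d.1 d.2 -> coprimez d'.1 d'.2 ->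
  normal d -> normal d' -> detz d d' = 0 -> d = d'.
Proof.
move=> /bezout_dir[e de] /bezout_dir[e' de'] nd nd' dd'.
pose a := detz d' e; pose b := detz d e'.
have ha1 : d'.1 = a * d.1.
  transitivity (d'.1 * detz d e - e.1 * detz d d'); first by rewrite de dd'; ring.
  by rewrite /a /detz; ring.
have ha2 : d'.2 = a * d.2.
  transitivity (d'.2 * detz d e - e.2 * detz d d'); first by rewrite de dd'; ring.
  by rewrite /a /detz; ring.
have ab : a * b = 1.
  by rewrite -de' /b /detz ha1 ha2; ring.
have a1 : a = 1.
  have /eqP := congr1 absz ab; rewrite abszM muln_eq1 => /andP[/eqP a1 _].
  case: (leP 0 a) => a0; first by lia.
  have am : a = -1 by lia.
  by move: nd nd'; rewrite /normal ha1 ha2 am; lia.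
by rewrite (surjective_pairing d) (surjective_pairing d') ha1 ha2 a1 !mul1r.
Qed.

(** The lattice points [c e] and [c e + d] of the first line determine both the direction and the
    height of the second. *)
Lemma line_inj d d' c c' : coprimez d.1 d.2 -> coprimez d'.1 d'.2 ->
  normal d -> normal d' -> line d c = line d' c' -> d = d' /\ c = c'.
Proof.
move=> cd cd' nd nd' ll; have [e de] := bezout_dir cd.
have on_line (a : int) : line d c (vec (shift (shift (0, 0) c e) a d)).
  rewrite /line /= det_vec; congr intr; rewrite -[RHS]mulr1 -de /detz /shift /=; ring.
have h0 := on_line 0; have h1 := on_line 1; rewrite ll /line /= in h0 h1.
move: h0 h1; rewrite !det_vec => /intr_inj h0 /intr_inj h1.
have dd' : d = d'.
  apply: colinear_normal => //; move: h0 h1; rewrite /detz /shift /=; lia.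
split=> //; move: (on_line 0); rewrite /line /= det_vec => /intr_inj <-.
by rewrite -h0 dd'.
Qed.

Section Count.
Variables (V : seq (int * int)) (D : nat -> int).
Hypotheses (D_eqlin : eqlin D) (D_ge : forall k, k%:Z <= D k).
Hypothesis D_max : forall k, (0 < k)%N ->
  (exists z d, [/\ coprimez d.1 d.2, cone (map vec V) (vec z) k%:R &
     cone (map vec V) (vec (shift z (D k) d)) k%:R]) /\
  forall z d g, coprimez d.1 d.2 -> cone (map vec V) (vec z) k%:R ->
     cone (map vec V) (vec (shift z g d)) k%:R -> g <= D k.

Lemma lattice_diamE k : (0 < k)%N -> lattice_diam (dilate k (hull V)) = (D k)%:~R.
Proof.
move=> k0; have [[z [d [cd Vz Vzd]]] Dmax] := D_max k0.
have Dk0 : 0 < D k by apply: lt_le_trans (D_ge k).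
rewrite /lattice_diam; set E := [set _ | _ in _ & _ in _].
have ubE : ubound E (D k)%:~R.
  move=> _ [x [/(dilate_cone _ _ k0) Vx /Z2P[w1 xE]]
           [y [/(dilate_cone _ _ k0) Vy /Z2P[w2 yE]] <-]]; subst x y.
  (* Equal end points form a segment of length 0, seen as a zero shift in the direction [d] at
     hand. *)
  case: (pselect (w1 = w2)) => [<-|/exists_primitive[g [e [g0 ce w2E]]]].
    have -> : w1 = shift w1 0 d by rewrite /shift !mul0r !addr0 -surjective_pairing.
    by rewrite {1}/shift !mul0r !addr0 /= -surjective_pairing segment_length_primitive // ler0z (ltW Dk0).
  rewrite w2E segment_length_primitive ?(ltW g0) // ler_int.
  by apply: (Dmax w1 e) => //; rewrite -w2E.
have DE : E (D k)%:~R.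
  exists (vec z); first by split; [exact/dilate_cone|apply/Z2P; exists z].
  exists (vec (shift z (D k) d)).
    by split; [exact/dilate_cone|apply/Z2P; eexists].
  by rewrite segment_length_primitive // (ltW Dk0).
apply/eqP; rewrite eq_le; apply/andP; split; first by apply: ge_sup => //; exists (D k)%:~R.
by apply: ub_le_sup => //; exists (D k)%:~R.
Qed.

Definition heights d k : set int := [set c | exists z, [/\ detz d z = c,
  cone (map vec V) (vec z) k%:R & cone (map vec V) (vec (shift z (D k) d)) k%:R]].

Definition directions := undup [seq d <- box (2 * bound V) | normal d].

Lemma bound_ge0 : 0 <= bound V.
Proof. by rewrite sumr_ge0 // => v _; rewrite addr_ge0. Qed.

Lemma mem_directions d : (d \in directions) =
  [&& normal d, coprimez d.1 d.2, `|d.1| <= 2 * bound V & `|d.2| <= 2 * bound V].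
Proof. by rewrite mem_undup mem_filter mem_box // mulr_ge0 // bound_ge0. Qed.

(** A diameter line has exactly two opposite primitive directions; choosing the normal one may
    require traversing its chord from the other end. *)
Lemma diameter_linesE k : (0 < k)%N ->
  [set l | lattice_diam_line (dilate k (hull V)) l] =
  \bigcup_(d in [set` directions]) (line d @` heights d k).
Proof.
move=> k0; have k0' : 0 < k%:R :> R by rewrite ltr0n.
have Dk0 : 0 < D k by apply: lt_le_trans (D_ge k).
apply/seteqP; split=> l /=; last first.
  move=> [d dd [c [z [zc Vz Vzd]] <-]]; move: dd; rewrite /= mem_directions.
  move=> /and4P[_ cd _ _]; exists (vec z), (vec (shift z (D k) d)).
  split; rewrite ?aff_hull_line ?zc ?lattice_diamE ?segment_length_primitive ?(ltW Dk0) //.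
  - by split; [exact/dilate_cone|apply/Z2P; eexists].
  - by split; [exact/dilate_cone|apply/Z2P; eexists].
  - exact: vec_shift_neq.
move=> [x [y [[/(dilate_cone _ _ k0) Vx /Z2P[z xE]]]]].
move=> [/(dilate_cone _ _ k0) Vy /Z2P[w yE]]; subst x y => zw.
have [g [d [g0 cd wE]]] : exists (g : int) d,
  [/\ 0 < g, coprimez d.1 d.2 & w = shift z g d].
  by apply: exists_primitive => h; apply: zw; rewrite h.
subst w; rewrite lattice_diamE // segment_length_primitive ?(ltW g0) //.
move=> /intr_inj gE lE; subst g.
rewrite aff_hull_line // in lE; subst l.
(* Since [D k] is at least [k], the factor [k] cancels in the chord bound: the list of directions is
   the same for all dilates. *)
have dbox : `|d.1| <= 2 * bound V /\ `|d.2| <= 2 * bound V.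
  have := Vy; rewrite vec_shift => /(chord_bound Vx).
  have Dk : k%:R <= (D k)%:~R :> R by rewrite -[k%:R]/(k%:Z%:~R) ler_int.
  have le_a (a : int) : (D k)%:~R * `|a|%:~R <= 2 * (bound V)%:~R * k%:R :> R ->
      `|a| <= 2 * bound V.
    move=> h; rewrite -(ler_int R) -(ler_pM2r k0') rmorphM /=.
    by apply: le_trans h; rewrite mulrC ler_wpM2r // ler0z.
  by move=> [/le_a h1 /le_a h2].
have [nd|nd] := normal_or_opp cd.
  exists d; first by rewrite /= mem_directions nd cd; case: dbox => -> ->.
  by exists (detz d z) => //; exists z.
exists (- d.1, - d.2).
  rewrite /= mem_directions nd /= (primitive_opp cd) !normrN.
  by case: dbox => -> ->.
(* Reversing the direction changes the sign of the height and starts the chord at its other end. *)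
exists (- detz d z).
  exists (shift z (D k) d); split=> //; first by rewrite /detz /shift /=; ring.
  suff -> : shift (shift z (D k) d) (D k) (- d.1, - d.2) = z by [].
  by rewrite [RHS]surjective_pairing /shift /=; congr pair; ring.
have opp x : det (vec (- d.1, - d.2)) x = - det (vec d) x.
  by rewrite /det !mxE /= !rmorphN /=; ring.
by apply/seteqP; split=> x; rewrite /line /= opp rmorphN => /eqP;
  rewrite ?eqr_opp => /eqP // ->.
Qed.

Lemma cone_lattice (F : seq (int * int * int)) : (forall x s, cone (map vec V) x s <->
    {in F, forall f, 0 <= functional f x s}) ->
  forall z k, cone (map vec V) (vec z) k%:R <-> {in F, forall f, 0 <= eval f z k%:Z}.
Proof.
move=> FP z k; rewrite FP.
have fE f : (0 <= functional f (vec z) k%:R) = (0 <= eval f z k%:Z).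
  by rewrite -[k%:R]/(k%:Z%:~R) functionalE ler0z.
by split=> H f /H; rewrite fE.
Qed.

Lemma heights_bound d k c : heights d k c ->
  - ((`|d.1| + `|d.2|) * bound V * k%:Z) <= c <= (`|d.1| + `|d.2|) * bound V * k%:Z.
Proof.
move=> [z [<- /cone_bound[+ +] _]]; rewrite !mxE /= -!intr_norm.
rewrite -[k%:R]/(k%:Z%:~R) -!intrM !ler_int -ler_norml => h1 h2.
rewrite /detz; apply: le_trans (ler_normB _ _) _; rewrite !normrM -mulrA mulrDl.
by apply: lerD; apply: ler_wpM2l.
Qed.

Lemma heights_finite d k : finite_set (heights d k).
Proof.
pose K := (`|d.1| + `|d.2|) * bound V * k%:Z.
by apply: sub_finite_set (finite_itvz (- K) K) => c; exact: heights_bound.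
Qed.

(** In the lattice basis [(d, e)] a starting point is [a d + c e], of height [c]. Membership of both
    chord ends in the dilate becomes a system of integral inequalities in [a] and [c], with [a]
    existentially quantified. *)
Lemma eqlin_heights d : coprimez d.1 d.2 -> eqlin (fun k => (ncard (heights d k))%:Z).
Proof.
move=> cd; have [e de] := bezout_dir cd; have [F FP] := cone_halfspaces R V.
pose K := (`|d.1| + `|d.2|) * bound V.
have Ehi : eqlin (fun k => K * k%:Z) by apply: eqlinZ; exact: eqlin_id.
(* The boolean tells the two ends apart: [true] is the far end, displaced by [D k] steps along
   [d]. *)
pose off (i : (int * int * int) * bool) (k : nat) :=
  i.1.2 * k%:Z + eval i.1 d 0 * (if i.2 then D k else 0).
pose idx := [seq (f, b) | f <- F, b <- [:: true; false]].
have Eoff : {in idx, forall i, eqlin (off i)}.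
  move=> [f b] _; rewrite /off /=; apply: eqlinD.
    by apply: eqlinZ; exact: eqlin_id.
  by apply: eqlinZ; case: b; [|exact: eqlin_cst].
have := eqlin_count2 (fun i : (int * int * int) * bool => eval i.1 d 0)
  (fun i => eval i.1 e 0) Eoff (eqlinN Ehi) Ehi.
apply: eqlin_ext => k; congr (ncard _)%:Z.
have evalE f a c : eval f (shift (shift (0, 0) a d) c e) k%:Z =
    eval f d 0 * a + (eval f e 0 * c + off (f, false) k).
  by rewrite /off /eval /shift /=; ring.
have evalE' f a c : eval f (shift (shift (shift (0, 0) a d) c e) (D k) d) k%:Z =
    eval f d 0 * a + (eval f e 0 * c + off (f, true) k).
  by rewrite /off /eval /shift /=; ring.
apply/seteqP; split=> c /=.
  move=> [_ [a H]]; exists (shift (shift (0, 0) a d) c e); split.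
  - by rewrite -[RHS]mulr1 -de /detz /shift /=; ring.
  - apply/(cone_lattice FP) => f fF; rewrite evalE.
    by apply: (H (f, false)); apply/allpairsP; exists (f, false).
  - apply/(cone_lattice FP) => f fF; rewrite evalE'.
    by apply: (H (f, true)); apply/allpairsP; exists (f, true).
move=> hc; have := heights_bound hc; rewrite -/K => ->; split=> //.
move: hc => [z [zc /(cone_lattice FP) Hz /(cone_lattice FP) HzD]].
have zE : z = shift (shift (0, 0) (detz z e) d) c e.
  rewrite [LHS]surjective_pairing /shift -zc /=; congr pair.
    by rewrite -[LHS]mulr1 -de /detz; ring.
  by rewrite -[LHS]mulr1 -de /detz; ring.
exists (detz z e) => -[f b] /allpairsP[[f' b'] /= [fF _ [-> ->]]].
by case: b'; [rewrite -evalE' -zE; exact: HzD|rewrite -evalE -zE; exact: Hz].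
Qed.

(** Lines with distinct normal directions or distinct heights are distinct, so for [k > 0] the count
    is a sum over a list of directions independent of [k]. *)
Lemma LD_eqlin : eqlin (fun k => (LD (hull V) k)%:Z).
Proof.
have := eqlin_sum (s := directions) (g := fun d k => (ncard (heights d k))%:Z).
have h : {in directions, forall d, eqlin (fun k => (ncard (heights d k))%:Z)}.
  by move=> d; rewrite mem_directions => /and4P[_ cd _ _]; exact: eqlin_heights.
move=> /(_ h); apply: (@eqlin_eventually _ _ 1) => k k0.
rewrite /LD diameter_linesE // ncard_bigcup ?undup_uniq //.
- rewrite (big_morph Posz PoszD (erefl _)) !big_seq; apply: eq_bigr => d dd.
  rewrite ncard_image //; last exact: heights_finite.
  move: dd; rewrite mem_directions => /and4P[nd cd _ _] c c'.
  by case/(line_inj cd cd nd nd).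
- by move=> d _; apply: finite_image; exact: heights_finite.
- move=> d d'; rewrite !mem_directions => /and4P[nd cd _ _] /and4P[nd' cd' _ _].
  by move=> [_ [[c _ <-] [c' _ /esym/(line_inj cd cd' nd nd')[]]]].
Qed.

Lemma LD_gt0 k : (0 < k)%N -> (0 < LD (hull V) k)%N.
Proof.
move=> k0; have [[z [d [cd Vz Vzd]]] _] := D_max k0.
have Dk0 : 0 < D k by apply: lt_le_trans (D_ge k).
have fin : finite_set [set l | lattice_diam_line (dilate k (hull V)) l].
  rewrite diameter_linesE //; apply: bigcup_finite => // d' _.
  by apply: finite_image; exact: heights_finite.
rewrite /LD cardfs_gt0; apply/fset0Pn; exists (line d (detz d z)).
rewrite in_fset_set //; apply/mem_set => /=.
exists (vec z), (vec (shift z (D k) d)).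
split; rewrite ?aff_hull_line ?lattice_diamE ?segment_length_primitive ?(ltW Dk0) //.
- by split; [exact/dilate_cone|apply/Z2P; eexists].
- by split; [exact/dilate_cone|apply/Z2P; eexists].
- exact: vec_shift_neq.
Qed.

End Count.

(** If all generators coincided, the polygon and its affine hull would be a single point. *)
Lemma distinct_vertices V (P : set 'rV[R]_2) : P = hull V -> aff_hull P = setT ->
  exists u1 u2, [/\ u1 \in V, u2 \in V & u1 <> u2].
Proof.
move=> PE affT; apply: contrapT => H.
have [u Vu] : exists u, {in V, forall v, v = u}.
  case: V H {PE} => [|u V'] H; first by exists (0, 0).
  exists u => v vV; apply: contrapT => vu; apply: H; exists v, u.
  by rewrite mem_head.
have sub1 : P `<=` [set vec u].
  rewrite PE; apply: smallest_sub => [|_ /= /mapP[v /Vu -> ->]] //.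
  apply/convex_setP => x y t _ /= -> ->.
  by apply/rowP => i; rewrite !mxE; ring.
have : aff_hull P `<=` [set vec u].
  apply: smallest_sub => // x y t /= -> ->.
  by apply/rowP => i; rewrite !mxE; ring.
rewrite affT => /(_ (vec (shift u 1 (1, 0))) I) /= /esym; apply: vec_shift_neq => //.
Qed.

End DiameterLines.

Theorem theorem3p6 (R : realType) (P : set 'rV[R]_2) :
  lattice_polygon P ->
  exists q : nat, (0 < q)%N /\
    exists (n p : nat) (f : int -> R),
      [/\ (n <= 1)%N, quasi_polynomial n p f, (p %| q)%N
        & forall k : nat, (q <= k)%N -> (LD P k)%:R = f k%:Z].
Proof.
move=> [[s /finite_seqP[r ->] PE] affT VZ].
have [W [WE WV]] := exists_vertices r.
(* Irredundant generators are vertices, hence lattice points, and can be replaced by a list of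
   integer pairs. *)
have [V VE] : exists V : seq (int * int), W = map (@vec R) V.
  have : {in W, forall w, exists z, w = vec R z}.
    by move=> w /WV wv; apply/Z2P/VZ; rewrite PE -WE.
  elim: W {WE WV} => [|w W IHW] H; first by exists [::].
  have [|V ->] := IHW; first by move=> u uW; apply: H; rewrite inE uW orbT.
  by have [z ->] := H w (mem_head _ _); exists (z :: V).
subst W; have {}PE : P = conv_hull [set` map (@vec R) V] by rewrite WE.
have [u1 [u2 [u1V u2V u12]]] := distinct_vertices PE affT.
have [D [ED D_ge D_max]] := lattice_chord_length WV u1V u2V u12.
rewrite PE; apply: eqlin_quasi_polynomial.
  by move=> k; exact: LD_gt0 D_ge D_max _.
exact: LD_eqlin ED D_ge D_max.
Qed.
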